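(* Let $\Omega$ be an eventually outward quiver with underlying graph $A_{\infty,\infty}$ and let $V$ be a (possibly infinite-dimensional) representation of $\Omega$ over a field $\mathbb{F}$. Then $V$ can be written as a direct sum of representations, each of which is isomorphic to $W^\alpha$ for some connected full subquiver $\alpha\in\mathcal{C}$ of $\Omega$, where $W^\alpha = F^\alpha/\sum_{\beta<\alpha}F^\beta$; and each $W^\alpha$ is isotypic.
   Context: A quiver $\Omega$ consists of a set $\Omega_0$ of vertices, a set $\Omega_1$ of arrows, and source and target functions $s,t:\Omega_1\to\Omega_0$. The graph $A_{\infty,\infty}$ has a vertex for each integer and one edge between each pair of consecutive integers; $\Omega$ has underlying graph $A_{\infty,\infty}$ if it is obtained by orienting each edge. $\Omega$ is eventually outward if all but finitely many arrows to the right of vertex $0$ point right and all but finitely many arrows to the left of vertex $0$ point left (equivalently, every injective journey, i.e. injective walk with a starting vertex, contains only finitely many arrows traversed against their orientation). Removing an arrow $e$ splits $\Omega$ into two connected subquivers: the one containing $t(e)$ is in front of $e$, and the one containing $s(e)$ is behind $e$. Vertices, arrows or subquivers contained in the former (latter) are said to be in front of (behind) $e$, and $e$ points towards (away from) them. $\mathcal{C}$ is the set of (nonempty) connected full subquivers of $\Omega$. A boundary arrow of $\alpha\in\mathcal{C}$ is an arrow with exactly one endpoint in $\alpha$; $\mathrm{iba}(\alpha)$ (resp. $\mathrm{oba}(\alpha)$) is the set of boundary arrows pointing towards (resp. away from) $\alpha$. $\beta$ is a reduction of $\alpha$ if there is an arrow $e$ in $\alpha$ such that $\beta$ is the portion of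 $\alpha$ behind $e$; $\beta$ is an enhancement of $\alpha$ if there is an arrow $e$ in $\beta$ such that $\alpha$ is the portion of $\beta$ in front of $e$. Write $\alpha>\beta$ if $\beta$ is obtained from $\alpha$ by a finite sequence of one or more reductions and enhancements. A representation $V$ of $\Omega$ over $\mathbb{F}$ consists of an $\mathbb{F}$-vector space $V_i$ for each vertex $i$ and a linear map $f_e:V_{s(e)}\to V_{t(e)}$ for each arrow $e$. The transport of a subspace of $V_i$ to a vertex $j$ is obtained by following the unique injective walk from $i$ to $j$ and successively taking the image under $f_e$ when the walk crosses $e$ from $s(e)$ to $t(e)$, and the preimage under $f_e$ when it crosses $e$ from $t(e)$ to $s(e)$. For an arrow $e$, the subrepresentation $V^{e,+}$ has $V^{e,+}_i=V_i$ if $i$ is behind $e$, and otherwise the transport of $V_{t(e)}$ from $t(e)$ to $i$. The subrepresentation $V^{e,-}$ has $V^{e,-}_i=0$ if $i$ is in front of $e$, and otherwise the transport of $\{0\}\subseteq V_{t(e)}$ to $i$. A virtual arrow $E$ is an infinite injective journey all of whose arrows are oriented away from its start; $V^{E,+}_i=V_i$ if $i\in E$, and otherwise the transport to $i$ of $V_j$, with $j$ the vertex of $E$ closest to $i$. This is unchanged if $E$ is replaced by an end segment of $E$. If $E$ lies in $\alpha$ it is a virtual boundary arrow of $\alpha$. For $\alpha\in\mathcal{C}$, $F^\alpha\subseteq V$ is the intersection of all $V^{e,+}$ for $e\in\mathrm{iba}(\alpha)$, all $V^{e,-}$ for $e\in\mathrm{oba}(\alpha)$, and all $V^{E,+}$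 for $E$ a virtual boundary arrow of $\alpha$. A representation is indecomposable if it is nonzero and is not a direct sum of two proper nonzero subrepresentations. A representation $W$ is isotypic if there are an indecomposable representation $X$, a vector space $Y$, and isomorphisms $W_i\cong X_i\otimes Y$ for every vertex $i$, under which each map $f^W_e$ corresponds to $f^X_e\otimes 1$. *)

(* Defs.v *)
From HB Require Import structures.
From Stdlib Require Import Relation_Operators.
From mathcomp Require Import all_boot all_order all_algebra.
From mathcomp Require Import generic_quotient ring_quotient zify.
From mathcomp Require Import boolp classical_sets functions cardinality fsbigop.

Set Implicit Arguments.
Unset Strict Implicit.
Unset Printing Implicit Defensive.

Import Order.TTheory GRing.Theory Num.Theory.
Local Open Scope classical_set_scope.
Local Open Scope ring_scope.
Local Open Scope quotient_scope.

Section LinearAlgebra.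
Variables (F : fieldType) (M : lmodType F).

Definition lin_closed (U : set M) : Prop :=
  U 0 /\ forall (a : F) (x y : M), U x -> U y -> U (a *: x + y).

Record lsubspace := LSubspace { lsub_set :> M -> Prop; lsubP : lin_closed lsub_set }.

Definition lsub_pred (U : lsubspace) : {pred M} := [pred x | `[< U x >]].

Lemma lsub_predE (U : lsubspace) x : (x \in lsub_pred U) = `[< U x >].
Proof. by []. Qed.

Fact lsub_submod_closed (U : lsubspace) : submod_closed (lsub_pred U).
Proof.
have [U0 UL] := lsubP U; split; first exact/asboolP.
move=> a x y /asboolP Ux /asboolP Uy; apply/asboolP; exact: UL.
Qed.

HB.instance Definition _ (U : lsubspace) :=
  GRing.isSubmodClosed.Build F M (lsub_pred U) (lsub_submod_closed U).

Definition lsub (U : lsubspace) := {x : M | x \in lsub_pred U}.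

HB.instance Definition _ U := Choice.on (lsub U).
HB.instance Definition _ U := SubType.on (lsub U).
HB.instance Definition _ U := [SubChoice_isSubLmodule of lsub U by <:].

Definition lquot (U : lsubspace) := Quotient.quot (lsub_pred U).

HB.instance Definition _ U := GRing.Zmodule.on (lquot U).
HB.instance Definition _ U := EqQuotient.on (lquot U).

Definition lquot_pi (U : lsubspace) (x : M) : lquot U := \pi_(lquot U) x.

Lemma lquot_eqP (U : lsubspace) (x y : M) :
  lquot_pi U x = lquot_pi U y <-> U (x - y).
Proof.
rewrite /lquot_pi; split.
  by move=> /eqP; rewrite -Quotient.idealrBE => /asboolP.
by move=> Uxy; apply/eqP; rewrite -Quotient.idealrBE; apply/asboolP.
Qed.

Lemma lquot_piK (U : lsubspace) (q : lquot U) : lquot_pi U (repr q) = q.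
Proof. exact: reprK. Qed.

Lemma lquot_reprP (U : lsubspace) (x : M) : U (repr (lquot_pi U x) - x).
Proof. by apply/lquot_eqP; rewrite lquot_piK. Qed.

Lemma lquot_piD (U : lsubspace) x y :
  lquot_pi U (x + y) = lquot_pi U x + lquot_pi U y.
Proof. by rewrite /lquot_pi; exact: (Quotient.pi_add (lsub_pred U)). Qed.

Definition lquot_scale (U : lsubspace) (a : F) (q : lquot U) : lquot U :=
  lquot_pi U (a *: repr q).

Lemma lquot_scale_pi (U : lsubspace) a x :
  lquot_scale a (lquot_pi U x) = lquot_pi U (a *: x).
Proof.
apply/lquot_eqP; rewrite -scalerBr -[_ *: _]addr0.
by case: (lsubP U) => U0 UL; apply: UL => //; exact: lquot_reprP.
Qed.

Fact lquot_scaleA (U : lsubspace) a b (q : lquot U) :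
  lquot_scale a (lquot_scale b q) = lquot_scale (a * b) q.
Proof. by rewrite -[q]lquot_piK !lquot_scale_pi scalerA. Qed.

Fact lquot_scale1 (U : lsubspace) : left_id 1 (@lquot_scale U).
Proof. by move=> q; rewrite -[q]lquot_piK !lquot_scale_pi scale1r. Qed.

Fact lquot_scaleDr (U : lsubspace) : right_distributive (@lquot_scale U) +%R.
Proof.
move=> a p q; rewrite -[p]lquot_piK -[q]lquot_piK -lquot_piD !lquot_scale_pi.
by rewrite scalerDr lquot_piD.
Qed.

Fact lquot_scaleDl (U : lsubspace) (q : lquot U) :
  {morph (@lquot_scale U)^~ q : a b / a + b}.
Proof.
by move=> a b; rewrite -[q]lquot_piK !lquot_scale_pi scalerDl lquot_piD.
Qed.

HB.instance Definition _ U := GRing.Zmodule_isLmodule.Build F (lquot U)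
  (@lquot_scaleA U) (@lquot_scale1 U) (@lquot_scaleDr U) (@lquot_scaleDl U).

Fact lquot_pi_linear U : linear (lquot_pi U).
Proof. by move=> a x y; rewrite lquot_piD -lquot_scale_pi. Qed.

HB.instance Definition _ U :=
  GRing.isLinear.Build F M (lquot U) _ (lquot_pi U) (lquot_pi_linear U).

End LinearAlgebra.

Definition bilinear_map (F : fieldType) (A B T : lmodType F) (b : A -> B -> T) :=
  (forall x, linear (b x)) /\ (forall y, linear (b ^~ y)).

(* [T], with the pairing [b x y] in the role of x (x) y, is a tensor product   *)
(* of [A] and [B] over [F].                                                    *)
Definition is_tensor_product (F : fieldType) (A B T : lmodType F)
    (b : A -> B -> T) : Prop :=
  bilinear_map b /\
  forall (Z : lmodType F) (g : A -> B -> Z), bilinear_map g ->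
    exists! h : T -> Z, linear h /\ forall x y, h (b x y) = g x y.

Record quiver := Quiver {
  qvert : eqType;
  qarr : eqType;
  src : qarr -> qvert;
  tgt : qarr -> qvert }.

Arguments src : simpl never.
Arguments tgt : simpl never.

Section Walks.
Variable Q : quiver.

Inductive walk (i : qvert Q) : qvert Q -> Type :=
| walk_nil : walk i i
| walk_fwd (e : qarr Q) : walk i (src e) -> walk i (tgt e)
| walk_bwd (e : qarr Q) : walk i (tgt e) -> walk i (src e).

Arguments walk_nil {i}.

(* Both lists are in reverse order of traversal.                              *)
Fixpoint walk_verts i j (w : walk i j) : seq (qvert Q) :=
  match w with
  | walk_nil => [:: i]
  | walk_fwd e w' => tgt e :: walk_verts w'
  | walk_bwd e w' => src e :: walk_verts w'
  end.

Fixpoint walk_arrs i j (w : walk i j) : seq (qarr Q) :=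
  match w with
  | walk_nil => [::]
  | walk_fwd e w' | walk_bwd e w' => e :: walk_arrs w'
  end.

Definition walk_inj i j (w : walk i j) : bool := uniq (walk_verts w).

Definition in_front (e : qarr Q) : set (qvert Q) :=
  [set i | exists w : walk (tgt e) i, e \notin walk_arrs w].

Definition behind (e : qarr Q) : set (qvert Q) :=
  [set i | exists w : walk (src e) i, e \notin walk_arrs w].

(* A full subquiver is given by its set of vertices.                          *)
Record csubquiver := CSubquiver {
  sq_verts :> set (qvert Q);
  sq_nonempty : sq_verts !=set0;
  sq_connected : forall i j, sq_verts i -> sq_verts j ->
    exists w : walk i j, forall k, k \in walk_verts w -> sq_verts k }.

Definition arrow_in (a : set (qvert Q)) (e : qarr Q) : Prop :=
  a (src e) /\ a (tgt e).

Definition boundary_arrow (a : set (qvert Q)) (e : qarr Q) : Prop :=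
  (a (src e) /\ ~ a (tgt e)) \/ (~ a (src e) /\ a (tgt e)).

Definition iba (a : set (qvert Q)) : set (qarr Q) :=
  [set e | boundary_arrow a e /\ a `<=` in_front e].

Definition oba (a : set (qvert Q)) : set (qarr Q) :=
  [set e | boundary_arrow a e /\ a `<=` behind e].

Definition reduction (a b : csubquiver) : Prop :=
  exists2 e, arrow_in a e & b = a `&` behind e :> set (qvert Q).

Definition enhancement (a b : csubquiver) : Prop :=
  exists2 e, arrow_in b e & a = b `&` in_front e :> set (qvert Q).

(* [sq_gt a b] is a > b; [clos_trans] is the transitive (not reflexive)       *)
(* closure.                                                                   *)
Definition sq_gt : csubquiver -> csubquiver -> Prop :=
  clos_trans csubquiver (fun a b => reduction a b \/ enhancement a b).

Record varrow := VArrow {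
  va_vert : nat -> qvert Q;
  va_arr : nat -> qarr Q;
  va_src : forall n, src (va_arr n) = va_vert n;
  va_tgt : forall n, tgt (va_arr n) = va_vert n.+1;
  va_inj : injective va_vert }.

Definition va_set (E : varrow) : set (qvert Q) := range (va_vert E).

End Walks.

Arguments walk_nil {Q i}.

Section Representations.
Variables (F : fieldType) (Q : quiver).

Record rep := Rep {
  rep_sp :> qvert Q -> lmodType F;
  rep_map : forall e : qarr Q, {linear rep_sp (src e) -> rep_sp (tgt e)} }.

Record rep_iso_data (V W : rep) := RepIso {
  ri_map : forall i, {linear V i -> W i};
  ri_bij : forall i, bijective (ri_map i);
  ri_nat : forall e (x : V (src e)),
    ri_map (tgt e) (rep_map V e x) = rep_map W e (ri_map (src e) x) }.

Definition rep_iso (V W : rep) : Prop := inhabited (rep_iso_data V W).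

Record subrep (V : rep) := SubRep {
  sr_sp :> forall i, lsubspace (V i);
  sr_stable : forall e (x : V (src e)),
    sr_sp (src e) x -> sr_sp (tgt e) (rep_map V e x) }.

Section SubQuot.
Variables (V : rep) (U : subrep V).

Definition sub_map e (x : lsub (U (src e))) : lsub (U (tgt e)) :=
  exist _ (rep_map V e (val x))
    (asboolT (sr_stable (asboolW (valP x)))).

Fact sub_map_linear e : linear (@sub_map e).
Proof. by move=> a x y; apply: val_inj; rewrite /= linearP. Qed.

HB.instance Definition _ e :=
  GRing.isLinear.Build F _ _ _ (@sub_map e) (@sub_map_linear e).

Definition sub_rep : rep := @Rep (fun i => lsub (U i)) (fun e => @sub_map e).

Definition quot_map e (q : lquot (U (src e))) : lquot (U (tgt e)) :=
  lquot_pi (U (tgt e)) (rep_map V e (repr q)).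

Lemma quot_map_pi e (x : V (src e)) :
  quot_map (lquot_pi (U (src e)) x) = lquot_pi (U (tgt e)) (rep_map V e x).
Proof.
by apply/lquot_eqP; rewrite -linearB; apply/sr_stable/lquot_reprP.
Qed.

Fact quot_map_linear e : linear (@quot_map e).
Proof.
move=> a p q; rewrite -[p]lquot_piK -[q]lquot_piK -linearP !quot_map_pi.
by rewrite -linearP -linearP.
Qed.

HB.instance Definition _ e :=
  GRing.isLinear.Build F _ _ _ (@quot_map e) (@quot_map_linear e).

Definition quot_rep : rep := @Rep (fun i => lquot (U i)) (fun e => @quot_map e).

End SubQuot.

Section Restrict.
Variables (V : rep) (U S : subrep V).

Definition restrict_set i : set (sub_rep U i) :=
  [set x : lsub (U i) | S i (val x)].

Fact restrict_closed i : lin_closed (@restrict_set i).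
Proof.
have [S0 SL] := lsubP (S i); split; first by rewrite /restrict_set /= .
by move=> a x y Sx Sy; apply: SL.
Qed.

Fact restrict_stable e (x : sub_rep U (src e)) :
  LSubspace (@restrict_closed (src e)) x ->
  LSubspace (@restrict_closed (tgt e)) (rep_map (sub_rep U) e x).
Proof. exact: sr_stable. Qed.

(* [S], or its intersection with [U] if [S] is not contained in [U], as a      *)
(* subrepresentation of [U].                                                  *)
Definition restrict : subrep (sub_rep U) :=
  @SubRep (sub_rep U) (fun i => LSubspace (@restrict_closed i))
    restrict_stable.

End Restrict.

Section Span.
Variables (V : rep) (I : Type) (U : I -> subrep V).

Definition sum_set i : set (V i) :=
  [set x | exists n (k : 'I_n -> I) (u : 'I_n -> V i),
     (forall m, U (k m) i (u m)) /\ x = \sum_m u m].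

Fact sum_closed i : lin_closed (@sum_set i).
Proof.
split.
  exists 0%N, (fun m : 'I_0 => False_rect I (notF (valP m))), (fun=> 0).
  by split; [case | rewrite big_ord0].
move=> a x y [n [k [u [Hu ->]]]] [n' [k' [u' [Hu' ->]]]].
exists (n + n')%N,
  (fun m => match fintype.split m with inl m1 => k m1 | inr m2 => k' m2 end),
  (fun m => match fintype.split m with inl m1 => a *: u m1 | inr m2 => u' m2 end).
split.
  move=> m; case: (fintype.split m) => [m1|m2] //.
  case: (lsubP (U (k m1) i)) => U0 UL.
  by rewrite -[_ *: _]addr0; apply: UL.
rewrite big_split_ord scaler_sumr; congr (_ + _); apply: eq_bigr => m _.
  case: fintype.splitP => [m1|m2] /= E; first by rewrite (val_inj E).
  by have := ltn_ord m; lia.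
case: fintype.splitP => [m1|m2] /= E; first by have := ltn_ord m1; lia.
by rewrite (val_inj (addnI E)).
Qed.

Fact sum_stable e (x : V (src e)) :
  LSubspace (@sum_closed (src e)) x ->
  LSubspace (@sum_closed (tgt e)) (rep_map V e x).
Proof.
move=> [n [k [u [Hu ->]]]]; exists n, k, (fun m => rep_map V e (u m)).
by split=> [m|]; [apply/sr_stable/Hu | rewrite linear_sum].
Qed.

Definition sum_rep : subrep V :=
  @SubRep V (fun i => LSubspace (@sum_closed i)) sum_stable.

End Span.

(* [V] is the internal direct sum of the family [U]; [\sum_(k \in [set: I])]   *)
(* is the sum over the support of [u].                                        *)
Definition is_direct_sum (V : rep) (I : choiceType) (U : I -> subrep V) : Prop :=
  forall i (x : V i), exists! u : I -> V i,
    [/\ forall k, U k i (u k), finite_set [set k | u k != 0] &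
        x = \sum_(k \in [set: I]) u k].

Definition rep_nonzero (V : rep) : Prop := exists i (x : V i), x != 0.

Definition subrep_nonzero (V : rep) (U : subrep V) : Prop :=
  exists i x, U i x /\ x != 0.

Definition subrep_proper (V : rep) (U : subrep V) : Prop :=
  exists i x, ~ U i x.

Definition indecomposable (V : rep) : Prop :=
  rep_nonzero V /\
  ~ exists U : bool -> subrep V,
      is_direct_sum U /\ forall b, subrep_proper (U b) /\ subrep_nonzero (U b).

Definition isotypic (W : rep) : Prop :=
  exists (X : rep) (Y : lmodType F) (b : forall i, X i -> Y -> W i),
    [/\ indecomposable X,
        forall i, is_tensor_product (b i) &
        forall e (x : X (src e)) (y : Y),
          rep_map W e (b (src e) x y) = b (tgt e) (rep_map X e x) y].

Section Transport.
Variable V : rep.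

Fixpoint walk_transport i j (w : walk i j) (U : set (V i)) : set (V j) :=
  match w in walk _ j return set (V j) with
  | walk_nil => U
  | walk_fwd e w' => rep_map V e @` walk_transport w' U
  | walk_bwd e w' => rep_map V e @^-1` walk_transport w' U
  end.

(* Meant for quivers in which exactly one injective walk joins [i] to [j], as *)
(* is the case on the line: see [line_walk_exists] and [line_walk_unique].    *)
Definition transport i j (U : set (V i)) : set (V j) :=
  [set x | forall w : walk i j, walk_inj w -> walk_transport w U x].

Definition arrow_plus (e : qarr Q) i : set (V i) :=
  if `[< behind e i >] then setT
  else @transport (tgt e) i setT.

Definition arrow_minus (e : qarr Q) i : set (V i) :=
  if `[< in_front e i >] then [set 0]
  else @transport (tgt e) i [set 0].

End Transport.

End Representations.

Arguments transport {F Q} V i j U _.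
Arguments arrow_plus {F Q} V e i _.
Arguments arrow_minus {F Q} V e i _.

(* The edge between [e] and [e + 1] is the arrow [e]; it points right iff     *)
(* [o e].                                                                     *)
Definition line (o : int -> bool) : quiver :=
  @Quiver int int (fun e => if o e then e else e + 1)
                  (fun e => if o e then e + 1 else e).


Definition eventually_outward (o : int -> bool) : Prop :=
  finite_set [set e : int | 0 <= e /\ ~~ o e] /\
  finite_set [set e : int | e < 0 /\ o e].

Definition btw (i k j : int) : bool := (i <= k <= j) || (j <= k <= i).
Definition adj (i j : int) : bool := (j == i + 1) || (i == j + 1).

Section Line.
Variable o : int -> bool.
Notation Q := (line o).

Let adj_st (e : qarr Q) : adj (src e) (tgt e).
Proof. by rewrite /adj /src /tgt /=; case: (o e); rewrite eqxx ?orbT. Qed.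

Let adj_ts (e : qarr Q) : adj (tgt e) (src e).
Proof. by rewrite /adj /src /tgt /=; case: (o e); rewrite eqxx ?orbT. Qed.

Lemma line_st_neq (e : qarr Q) : src e != tgt e.
Proof.
have := adj_st e; move: (src e) (tgt e); rewrite /adj /= => a b ab.
by apply/eqP; move: ab; lia.
Qed.

Lemma walk_start i j (w : @walk Q i j) : i \in walk_verts w.
Proof. by elim: w => [|e w IH|e w IH]; rewrite inE ?eqxx ?IH ?orbT. Qed.

Lemma walk_end i j (w : @walk Q i j) : j \in walk_verts w.
Proof. by case: w => [|e w|e w]; rewrite inE eqxx. Qed.

Lemma line_walk_btw i j (w : @walk Q i j) k : btw i k j -> k \in walk_verts w.
Proof.
have step (a b c k0 : int) : adj b c -> btw a k0 c -> btw a k0 b || (k0 == c).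
  by rewrite /adj /btw; lia.
elim: w k => [|e w IH|e w IH] k /=.
- move=> ik; rewrite inE; move: ik; rewrite /btw; move: i k => /= i k; lia.
- move=> /(step _ _ _ _ (adj_st e)) /orP[/IH kw|/eqP ->]; rewrite inE ?eqxx //.
  by rewrite kw orbT.
- move=> /(step _ _ _ _ (adj_ts e)) /orP[/IH kw|/eqP ->]; rewrite inE ?eqxx //.
  by rewrite kw orbT.
Qed.

Lemma line_walk_inj_btw i j (w : @walk Q i j) :
  walk_inj w -> forall k, k \in walk_verts w -> btw i k j.
Proof.
have step (a b c k0 : int) :
    adj b c -> ~~ btw a c b -> btw a k0 b || (k0 == c) -> btw a k0 c.
  by rewrite /adj /btw; lia.
rewrite /walk_inj; elim: w => [|e w IH|e w IH] /=.
- by move=> _ k; rewrite inE => /eqP ->; rewrite /btw lexx.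
- move=> /andP[cw uw] k; rewrite inE => kw.
  apply: (step _ _ _ _ (adj_st e)).
    by apply: contra cw; apply: line_walk_btw.
  by case/orP: kw => [->|kw]; rewrite ?orbT // (IH uw).
- move=> /andP[cw uw] k; rewrite inE => kw.
  apply: (step _ _ _ _ (adj_ts e)).
    by apply: contra cw; apply: line_walk_btw.
  by case/orP: kw => [->|kw]; rewrite ?orbT // (IH uw).
Qed.

Let walk_ext i j k (e : qarr Q) (w : @walk Q i j) :
  (src e = j /\ tgt e = k) \/ (tgt e = j /\ src e = k) ->
  exists w' : @walk Q i k, walk_verts w' = k :: walk_verts w.
Proof.
case=> -[ej ek]; [case: _ / ej in w *|case: _ / ej in w *]; case: _ / ek.
  by exists (walk_fwd w).
by exists (walk_bwd w).
Qed.

Lemma line_walk_exists (i j : int) : exists w : @walk Q i j, walk_inj w.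
Proof.
have right (n : nat) : exists2 w : @walk Q i (i + n%:Z), walk_inj w
    & forall k : int, k \in walk_verts w -> (i <= k <= i + n%:Z).
  elim: n => [|n [w wi wb]].
    rewrite addr0; exists (walk_nil : @walk Q i i) => // k.
    by rewrite inE => /eqP ->; rewrite lexx.
  have [|w' w'E] := @walk_ext i _ (i + n.+1%:Z) (i + n%:Z) w.
    by rewrite /src /tgt /=; case: (o _); [left|right]; split; lia.
  exists w' => [|k]; rewrite /walk_inj w'E /=.
    by apply/andP; split; [apply/negP => /wb; lia | exact: wi].
  by rewrite inE => /orP[/eqP ->|/wb]; lia.
have left (n : nat) : exists2 w : @walk Q i (i - n%:Z), walk_inj w
    & forall k : int, k \in walk_verts w -> (i - n%:Z <= k <= i).
  elim: n => [|n [w wi wb]].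
    rewrite subr0; exists (walk_nil : @walk Q i i) => // k.
    by rewrite inE => /eqP ->; rewrite lexx.
  have [|w' w'E] := @walk_ext i _ (i - n.+1%:Z) (i - n.+1%:Z) w.
    by rewrite /src /tgt /=; case: (o _); [right|left]; split; lia.
  exists w' => [|k]; rewrite /walk_inj w'E /=.
    by apply/andP; split; [apply/negP => /wb; lia | exact: wi].
  by rewrite inE => /orP[/eqP ->|/wb]; lia.
case: (lerP i j) => ij.
  have [w wi _] := right `|j - i|%N.
  suff -> : j = i + `|j - i|%N%:Z by exists w.
  by lia.
have [w wi _] := left `|i - j|%N.
suff -> : j = i - `|i - j|%N%:Z by exists w.
by lia.
Qed.

Let arr_inj (e e' : qarr Q) : src e = src e' -> tgt e = tgt e' -> e = e'.
Proof. by rewrite /src /tgt /=; case: (o e) (o e') => [] [] /=; lia. Qed.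

Let arr_inj' (e e' : qarr Q) : src e = tgt e' -> tgt e = src e' -> e = e'.
Proof. by rewrite /src /tgt /=; case: (o e) (o e') => [] [] /=; lia. Qed.

Let uniq_step i p q j : adj p j -> adj q j -> btw i p j -> btw i q j -> p = q.
Proof. by rewrite /adj /btw; lia. Qed.

Let pred_btw i j k (w : @walk Q i j) :
  k \notin walk_verts w -> adj j k -> uniq (walk_verts w) -> btw i j k.
Proof.
move=> kw jk wi; have: ~~ btw i k j by apply: contra kw; apply: line_walk_btw.
by move: jk; rewrite /adj /btw; move: i j k {w kw wi} => /= i j k; lia.
Qed.

Lemma line_walk_unique i j (w w' : @walk Q i j) :
  walk_inj w -> walk_inj w' -> w = w'.
Proof.
suff H j' (w2 : @walk Q i j') (E : j = j') : walk_inj w -> walk_inj w2 ->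
    ecast k (@walk Q i k) E w = w2 by exact: (H j w' erefl).
rewrite /walk_inj {w'}.
elim: w j' w2 E => [|e w IH|e w IH] j' [|e' w'|e' w'] E /=.
- by rewrite eq_axiomK.
- by move=> _ /andP[/negP[]]; rewrite -E walk_start.
- by move=> _ /andP[/negP[]]; rewrite -E walk_start.
- by move=> /andP[/negP[]]; rewrite E walk_start.
- move=> /andP[nw uw] /andP[nw' uw'].
  have b := pred_btw nw (adj_st e) uw; have b' := pred_btw nw' (adj_st e') uw'.
  rewrite -E in b'; have a' := adj_st e'; rewrite -E in a'.
  have ee := arr_inj (uniq_step (adj_st e) a' b b') E.
  by case: _ / ee in w' E uw' nw' b' a' *; rewrite eq_axiomK /= (IH _ w' erefl).
- move=> /andP[nw uw] /andP[nw' uw'].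
  have b := pred_btw nw (adj_st e) uw; have b' := pred_btw nw' (adj_ts e') uw'.
  rewrite -E in b'; have a' := adj_ts e'; rewrite -E in a'.
  have ee := arr_inj' (uniq_step (adj_st e) a' b b') E.
  by case/negP: (line_st_neq e'); rewrite -E ee.
- by move=> /andP[/negP[]]; rewrite E walk_start.
- move=> /andP[nw uw] /andP[nw' uw'].
  have b := pred_btw nw (adj_ts e) uw; have b' := pred_btw nw' (adj_st e') uw'.
  rewrite -E in b'; have a' := adj_st e'; rewrite -E in a'.
  have ee := arr_inj' E (uniq_step (adj_ts e) a' b b').
  by case/negP: (line_st_neq e); rewrite E -ee.
- move=> /andP[nw uw] /andP[nw' uw'].
  have b := pred_btw nw (adj_ts e) uw; have b' := pred_btw nw' (adj_ts e') uw'.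
  rewrite -E in b'; have a' := adj_ts e'; rewrite -E in a'.
  have ee := arr_inj E (uniq_step (adj_ts e) a' b b').
  by case: _ / ee in w' E uw' nw' b' a' *; rewrite eq_axiomK /= (IH _ w' erefl).
Qed.

Variables (F : fieldType) (V : rep F Q).

Let last_step (i p b c : int) :
  adj p b -> adj c b -> c != p -> btw i c p -> btw i b p.
Proof. by rewrite /adj /btw; lia. Qed.

Let transport_step_cast i j (w : @walk Q i j) (U : set (V i)) :
  walk_inj w -> forall e (x : V (src e)), transport V _ _ U x ->
  forall H : tgt e = j, walk_transport w U (ecast k (V k) H (rep_map V e x)).
Proof.
move=> wi e x tx H; case: (boolP (src e \in walk_verts w)) => sw; last first.
  case: _ / H in w wi sw *.
  by have := tx (walk_bwd w); apply; rewrite /walk_inj /= sw.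
case: w wi H sw => [|e1 w1|e1 w1] wi H /=; rewrite inE.
- by move=> /eqP sE; case/negP: (line_st_neq e); rewrite H sE.
- move=> /predU1P[sE|sw].
    by case/negP: (line_st_neq e); rewrite H sE.
  move: wi; rewrite /walk_inj /= => /andP[nw uw].
  have [ee1|ne] := eqVneq e1 e.
    case: _ / ee1 in x tx H sw *.
    by rewrite eq_axiomK /=; exists x => //; apply: tx.
  case/negP: nw; apply: line_walk_btw.
  apply: (@last_step _ _ _ (src e)); rewrite ?adj_st //.
  + by rewrite -H adj_st.
  + by apply: contra_neq ne => ss; apply: arr_inj.
  + exact: (line_walk_inj_btw uw sw).
- move=> /predU1P[sE|sw].
    by case/negP: (line_st_neq e); rewrite H sE.
  move: wi; rewrite /walk_inj /= => /andP[nw uw].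
  case/negP: (nw); apply: line_walk_btw.
  apply: (@last_step _ _ _ (src e)); rewrite ?adj_ts //.
  + by rewrite -H adj_st.
  + apply/eqP => ss; have ee : e = e1 by apply: arr_inj'.
    by move: (line_st_neq e); rewrite H ee eqxx.
  + exact: (line_walk_inj_btw uw sw).
Qed.

Lemma transport_stable i (U : set (V i)) e (x : V (src e)) :
  transport V _ _ U x -> transport V _ _ U (rep_map V e x).
Proof. by move=> tx w wi; apply: (transport_step_cast wi tx (erefl _)). Qed.

Lemma walk_transport_closed i j (w : @walk Q i j) (U : set (V i)) :
  lin_closed U -> lin_closed (walk_transport w U).
Proof.
move=> HU; elim: w => [|e w [T0 TL]|e w [T0 TL]] //=; split.
- by exists 0; rewrite ?linear0.
- by move=> a _ _ [x Tx <-] [y Ty <-]; exists (a *: x + y); rewrite ?linearP //; apply: TL.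
- by rewrite /preimage /= linear0.
- by move=> a x y Tx Ty; rewrite /preimage /= linearP; apply: TL.
Qed.

Lemma transport_closed i j (U : set (V i)) :
  lin_closed U -> lin_closed (transport V i j U : set (V j)).
Proof.
move=> HU; split=> [w wi|a x y tx ty w wi].
  by case: (walk_transport_closed w HU).
by have [_] := walk_transport_closed w HU; apply; [apply: tx | apply: ty].
Qed.

Lemma transport_loop i (U : set (V i)) : transport V i i U = U.
Proof.
apply/seteqP; split=> [x /(_ (walk_nil))|x Ux w wi]; first exact.
suff H j (w' : @walk Q i j) (E : i = j) : walk_inj w' ->
    walk_transport w' U (ecast k (V k) E x) by apply: (H i w erefl).
case: w' E => [E _|e w' E|e w' E]; first by rewrite eq_axiomK.
  by move=> /andP[/negP[]]; rewrite -E walk_start.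
by move=> /andP[/negP[]]; rewrite -E walk_start.
Qed.

Let setT_closed i : lin_closed [set: V i]. Proof. by []. Qed.
Let set0_closed i : lin_closed [set 0 : V i].
Proof. by split=> // a x y -> ->; rewrite scaler0 addr0. Qed.

Fact arrow_plus_closed e i : lin_closed (arrow_plus V e i).
Proof.
by rewrite /arrow_plus; case: asboolP => _ //; apply: transport_closed.
Qed.

Fact arrow_minus_closed e i : lin_closed (arrow_minus V e i).
Proof.
by rewrite /arrow_minus; case: asboolP => _ //; apply: transport_closed.
Qed.

Let in_front_bwd (e e' : qarr Q) : in_front e (tgt e') -> ~ in_front e (src e') -> e' = e.
Proof.
move=> [w we] nf; apply: contra_notP nf => /eqP ne; exists (walk_bwd w).
by rewrite /= inE negb_or eq_sym ne.
Qed.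

Let behind_fwd (e e' : qarr Q) : behind e (src e') -> ~ behind e (tgt e') -> e' = e.
Proof.
move=> [w we] nb; apply: contra_notP nb => /eqP ne; exists (walk_fwd w).
by rewrite /= inE negb_or eq_sym ne.
Qed.

Fact arrow_plus_stable (e e' : qarr Q) (x : V (src e')) :
  arrow_plus V e _ x -> arrow_plus V e _ (rep_map V e' x).
Proof.
rewrite /arrow_plus; case: asboolP => b1; case: asboolP => b2 //.
  by case: _ / (behind_fwd b1 b2); rewrite transport_loop.
exact: transport_stable.
Qed.

Fact arrow_minus_stable (e e' : qarr Q) (x : V (src e')) :
  arrow_minus V e _ x -> arrow_minus V e _ (rep_map V e' x).
Proof.
rewrite /arrow_minus; case: asboolP => b1; case: asboolP => b2 //.
- by move=> ->; rewrite linear0.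
- by move=> ->; rewrite linear0; case: (transport_closed (tgt e') (@set0_closed (tgt e))).
- case: _ / (in_front_bwd b2 b1) => tx.
  have := tx (walk_bwd walk_nil); apply; rewrite /walk_inj /= inE andbT.
  exact: line_st_neq.
- exact: transport_stable.
Qed.

Let va_walk (E : varrow Q) m n : exists w : walk (va_vert E m) (va_vert E (m + n)),
  forall k, k \in walk_verts w -> va_set E k.
Proof.
elim: n => [|n [w wE]].
  by rewrite addn0; exists walk_nil => k; rewrite inE => /eqP ->; exists m.
have [|w' w'E] := @walk_ext _ _ (va_vert E (m + n.+1)) (va_arr E (m + n)) w.
  by left; rewrite va_src va_tgt addnS.
exists w' => k; rewrite w'E inE => /predU1P[->|/wE//].
by exists (m + n.+1)%N.
Qed.

Let va_convex (E : varrow Q) a b c :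
  va_set E a -> va_set E c -> btw a b c -> va_set E b.
Proof.
move=> [m _ <-] [n _ <-]; wlog mn : m n / (m <= n)%N => [hw|].
  case/orP: (leq_total m n) => mn; first exact: hw.
  by rewrite /btw orbC; apply: hw.
have [w wE] := va_walk E m (n - m); rewrite subnKC // in w wE *.
by move=> /(line_walk_btw w) /wE.
Qed.

(* On this quiver the distance between two vertices is the absolute value of  *)
(* their difference.                                                          *)
Definition va_closest (E : varrow Q) (i : int) : set int :=
  [set j | va_set E j /\ forall k : int, va_set E k -> `|i - j| <= `|i - k|].

Definition varrow_plus (E : varrow Q) (i : qvert Q) : set (V i) :=
  if `[< va_set E i >] then setT
  else [set x | forall j : qvert Q, va_closest E i j -> transport V j i setT x].

Fact varrow_plus_closed E i : lin_closed (@varrow_plus E i).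
Proof.
rewrite /varrow_plus; case: asboolP => _ //; split=> [j Ej|a x y tx ty j Ej].
  by case: (transport_closed i (@setT_closed j)).
case: (transport_closed i (@setT_closed j)) => _.
by apply; [apply: tx | apply: ty].
Qed.

Fact varrow_plus_stable E (e : qarr Q) (x : V (src e)) :
  varrow_plus E x -> varrow_plus E (rep_map V e x).
Proof.
rewrite /varrow_plus; case: asboolP => sE; case: asboolP => tE // tx j [Ej jm].
  suff -> : j = src e by apply: transport_stable; rewrite transport_loop.
  have nb : ~~ btw j (tgt e) (src e) by apply/negP => /(va_convex Ej sE).
  have jt : j != tgt e by apply: contra_notN tE => /eqP <-.
  move: (adj_st e) (jm _ sE) nb jt; rewrite /adj /btw.
  by move: (src e) (tgt e) j {Ej jm} => /= a b c; lia.
apply: transport_stable; apply: tx; split=> // k Ek.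
have ns : ~~ btw j (src e) k by apply/negP => /(va_convex Ej Ek).
have nt : ~~ btw j (tgt e) k by apply/negP => /(va_convex Ej Ek).
move: (adj_st e) (jm _ Ek) ns nt; rewrite /adj /btw.
by move: (src e) (tgt e) j k {Ej jm Ek} => /= a b c d; lia.
Qed.

Section Filtration.
Variable a : csubquiver Q.

Definition F_set i : set (V i) :=
  [set x | [/\ forall e, iba a e -> arrow_plus V e _ x,
               forall e, oba a e -> arrow_minus V e _ x &
               forall E, va_set E `<=` a -> varrow_plus E x]].

Fact F_closed i : lin_closed (@F_set i).
Proof.
split=> [|c x y [px mx vx] [py my vy]].
  split=> [e _|e _|E _].
  - by case: (arrow_plus_closed e i).
  - by case: (arrow_minus_closed e i).
  - by case: (varrow_plus_closed E i).
split=> [e ea|e ea|E Ea].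
- by case: (arrow_plus_closed e i) => _; apply; [apply: px | apply: py].
- by case: (arrow_minus_closed e i) => _; apply; [apply: mx | apply: my].
- by case: (varrow_plus_closed E i) => _; apply; [apply: vx | apply: vy].
Qed.

Fact F_stable (e : qarr Q) (x : V (src e)) :
  LSubspace (@F_closed (src e)) x -> LSubspace (@F_closed (tgt e)) (rep_map V e x).
Proof.
move=> [px mx vx]; split=> [e' /px|e' /mx|E /vx].
- exact: arrow_plus_stable.
- exact: arrow_minus_stable.
- exact: varrow_plus_stable.
Qed.

Definition F_rep : subrep V :=
  @SubRep F Q V (fun i => LSubspace (@F_closed i)) F_stable.

End Filtration.

Definition F_below (a : csubquiver Q) : subrep V :=
  sum_rep (fun b : {b : csubquiver Q | sq_gt a b} => F_rep (sval b)).

Definition W_rep (a : csubquiver Q) : rep F Q :=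
  quot_rep (restrict (F_rep a) (F_below a)).

End Line.

(* Main.v *)
Require Import Defs.
From HB Require Import structures.
From Stdlib Require Import Relation_Operators.
From mathcomp Require Import all_boot all_order all_algebra zify.
From mathcomp Require Import boolp classical_sets functions cardinality fsbigop.

Set Implicit Arguments.
Unset Strict Implicit.
Unset Printing Implicit Defensive.

Import Order.TTheory GRing.Theory Num.Theory.
Local Open Scope classical_set_scope.
Local Open Scope ring_scope.

(** An interval of the line is described by its two ends, and each end imposes
    a condition on its own side only: [F_set a] at a vertex [i] is the
    intersection of a left space and a right space ([F_set_side]).  The left
    space consists of the values at [i] of the families of vectors that are
    compatible with the arrows between [i] and the left end, and vanish beyond
    that end if its boundary arrow points outward.  Gluing a left and a right
    family at a vertex of the interval shows that, inside the interval, [F_set a]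
    is the image of the evaluation at [i] on the space of homomorphisms from the
    interval module of [a] to [V] ([side_space_homP]).  This replaces a choice of
    compatible lifts along the interval by a single vector space of families.

    The possible ends on one side are totally ordered ([end_lt]) in such a way
    that the side spaces grow with the end ([side_space_mono]) and that lowering
    one end of an interval is exactly a reduction or an enhancement ([step_ends],
    [ends_step]).  So inside [a] the space [F_below] is the sum of (strictly
    lower left, right) and (left, strictly lower right) ([below_decomp],
    [below_side_sub]), and outside [a] it is everything ([F_set_outside_below]).

    Whether a homomorphism from the interval module has its value in [F_below]
    does not depend on the vertex of the interval ([below_transfer]).  Hence a
    complement [C], in the space of homomorphisms, of those with values in
    [F_below] yields at every vertex a complement of [F_below] in [F_set], and
    these complements form a subrepresentation [core_rep], isomorphic to [W_rep]
    ([core_iso]) and visibly of the form interval module (x) [C]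
    ([W_rep_isotypic]).

    Finally [V] is the direct sum of the [core_rep]s.  They span: because the
    quiver is eventually outward, the order on ends is well founded, and peeling
    off the core component of a vector leaves vectors belonging to lower
    intervals ([span_interval]); one starts from the ends whose side space is the
    whole space ([side_space_full]).  They are independent: in a relation, the term
    whose pair of ends is lexicographically largest lies in [F_below], by the
    modular law for the left and right spaces, so it vanishes
    ([summand_indep]). *)

(** * Subspaces, complements and families of vectors *)

Section LinClosed.
Variables (F : fieldType) (M : lmodType F).
Implicit Types (U : set M) (x y : M).

Lemma lin_closed0 U : lin_closed U -> U 0.
Proof. by case. Qed.

Lemma lin_closedD U x y : lin_closed U -> U x -> U y -> U (x + y).
Proof. by move=> [_ UL] Ux Uy; rewrite -[x]scale1r; apply: UL. Qed.

Lemma lin_closedZ U a x : lin_closed U -> U x -> U (a *: x).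
Proof. by move=> [U0 UL] Ux; rewrite -[_ *: _]addr0; apply: UL. Qed.

Lemma lin_closedB U x y : lin_closed U -> U x -> U y -> U (x - y).
Proof.
move=> HU Ux Uy; apply: lin_closedD => //.
by rewrite -scaleN1r; apply: lin_closedZ.
Qed.

Lemma lin_closed_sum U (T : Type) (r : seq T) (P : pred T) (f : T -> M) :
  lin_closed U -> (forall t, P t -> U (f t)) -> U (\sum_(t <- r | P t) f t).
Proof.
move=> HU Uf; apply: big_ind => //; first exact: lin_closed0.
by move=> x y; apply: lin_closedD.
Qed.

(** A complement of [A] inside [B]: Zorn applied to the subspaces of [B] that
    meet [A] trivially. *)
Lemma exists_complement (A B : set M) :
  lin_closed A -> lin_closed B -> A `<=` B ->
  exists C : set M, [/\ lin_closed C, C `<=` B, (forall x, C x -> A x -> x = 0) &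
    forall x, B x -> exists2 c, C c & A (x - c)].
Proof.
move=> HA HB AB.
pose P (C : set M) := [/\ forall a x y, C x -> C y -> C (a *: x + y), C `<=` B &
  forall x, C x -> A x -> x = 0].
have [C [[CL CB CA] Cmax]] : exists C, P C /\ forall D, C `<` D -> ~ P D.
  apply: Zorn_bigcup => G GP Gtot; split.
  - move=> a x y [D GD Dx] [E GE Ey].
    case: (Gtot _ _ GD GE) => [DE|ED].
      by exists E => //; have [EL _ _] := GP _ GE; apply: EL => //; apply: DE.
    by exists D => //; have [DL _ _] := GP _ GD; apply: DL => //; apply: ED.
  - by move=> x [D GD Dx]; have [_ DB _] := GP _ GD; apply: DB.
  - by move=> x [D GD Dx]; have [_ _ DA] := GP _ GD; apply: DA.

(* A chain may be empty, so [P] cannot ask for [C 0]; hence the two cases        *)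
(* [C c \/ c = 0] in the span of [C] and one more vector [v].                   *)
pose ext v := [set x | exists a c, (C c \/ c = 0) /\ x = a *: v + c].
have extC v : C `<=` ext v.
  by move=> c Cc; exists 0, c; rewrite scale0r add0r; split=> //; left.
have C0cl a c c' : C c \/ c = 0 -> C c' \/ c' = 0 ->
    C (a *: c + c') \/ a *: c + c' = 0.
  move=> [Cc|->] [Cc'|->]; [by left; apply: CL | | |].
  - left; rewrite (_ : _ + 0 = (a - 1) *: c + c); first exact: CL.
    by rewrite scalerBl scale1r subrK addr0.
  - by left; rewrite scaler0 add0r.
  - by right; rewrite scaler0 addr0.
have C0B c : C c \/ c = 0 -> B c by case=> [/CB//|->]; apply: lin_closed0.
have extP v : B v -> (forall a c, (C c \/ c = 0) -> A (a *: v + c) -> a *: v + c = 0) ->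
    P (ext v).
  move=> Bv vA; split.
  - move=> a _ _ [b [c [Cc ->]]] [b' [c' [Cc' ->]]].
    exists (a * b + b'), (a *: c + c'); split; first exact: C0cl.
    by rewrite scalerDr scalerDl scalerA addrACA.
  - move=> _ [a [c [Cc ->]]]; apply: lin_closedD => //; last exact: C0B.
    exact: lin_closedZ.
  - by move=> _ [a [c [Cc ->]]]; apply: vA.
have C0 : C 0.
  apply: contrapT => nC0; apply: (Cmax (ext 0)); last first.
    apply: extP; first exact: lin_closed0.
    move=> a c Cc; rewrite scaler0 add0r => Ac.
    by case: Cc => // Cc; apply: CA.
  split; first exact: extC.
  move/(_ 0); apply: contra_not nC0; apply.
  by exists 0, 0; rewrite scaler0 addr0; split=> //; right.
exists C; split=> //.
move=> x Bx; apply: contrapT => nx; apply: (Cmax (ext x)).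
  split; first exact: extC.
  move/(_ x) => Cx; apply: nx; exists x; last by rewrite subrr; apply: lin_closed0.
  by apply: Cx; exists 1, 0; rewrite scale1r addr0; split=> //; right.
apply: extP => // a c Cc Aac; have {}Cc : C c by case: Cc => // ->.
have [a0|a0] := eqVneq a 0; first by move: Aac; rewrite a0 scale0r add0r; apply: CA.
case: nx; exists (- a^-1 *: c).
  by rewrite -[_ *: _]addr0; apply: CL.
rewrite (_ : x - _ = a^-1 *: (a *: x + c)); first exact: lin_closedZ.
by rewrite scalerDr scalerA mulVf // scale1r scaleNr opprK.
Qed.

End LinClosed.

Lemma linear_fun0 (F : fieldType) (A B : lmodType F) (f : A -> B) : linear f -> f 0 = 0.
Proof.
move=> fl; have := fl (-1) 0 0.
by rewrite scaler0 addr0 scaleN1r addNr.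
Qed.

Lemma linear_funZ (F : fieldType) (A B : lmodType F) (f : A -> B) c x :
  linear f -> f (c *: x) = c *: f x.
Proof. by move=> fl; rewrite -[c *: x]addr0 fl (linear_fun0 fl) addr0. Qed.

Section Families.
Variables (F : fieldType) (I : Type) (V : I -> lmodType F).

(** The product of the [V i], as a vector space: homomorphisms out of an interval
    module live in it, which allows a complement to be taken among them. *)
Definition family : Type := forall i, V i.

HB.instance Definition _ := gen_eqMixin family.
HB.instance Definition _ := gen_choiceMixin family.

Let fam0 : family := fun=> 0.
Let famN (z : family) : family := fun i => - z i.
Let famD (z w : family) : family := fun i => z i + w i.
Let famZ (a : F) (z : family) : family := fun i => a *: z i.

Fact famDA : associative famD.
Proof. by move=> x y z; apply: functional_extensionality_dep => i; exact: addrA. Qed.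
Fact famDC : commutative famD.
Proof. by move=> x y; apply: functional_extensionality_dep => i; exact: addrC. Qed.
Fact fam0D : left_id fam0 famD.
Proof. by move=> x; apply: functional_extensionality_dep => i; exact: add0r. Qed.
Fact famND : left_inverse fam0 famN famD.
Proof. by move=> x; apply: functional_extensionality_dep => i; exact: addNr. Qed.

HB.instance Definition _ := GRing.isZmodule.Build family famDA famDC fam0D famND.

Fact famZA a b z : famZ a (famZ b z) = famZ (a * b) z.
Proof. by apply: functional_extensionality_dep => i; exact: scalerA. Qed.
Fact fam1Z : left_id 1 famZ.
Proof. by move=> z; apply: functional_extensionality_dep => i; exact: scale1r. Qed.
Fact famZDr : right_distributive famZ +%R.
Proof. by move=> a x y; apply: functional_extensionality_dep => i; exact: scalerDr. Qed.
Fact famZDl z : {morph famZ^~ z : a b / a + b}.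
Proof. by move=> a b; apply: functional_extensionality_dep => i; exact: scalerDl. Qed.

HB.instance Definition _ :=
  GRing.Zmodule_isLmodule.Build F family famZA fam1Z famZDr famZDl.

Lemma family_linE a (z w : family) i : (a *: z + w) i = a *: z i + w i.
Proof. by []. Qed.

Lemma family_subE (z w : family) i : (z - w) i = z i - w i.
Proof. by []. Qed.

End Families.

(** * Ends of intervals and their order *)

(** Both sides of the line are treated at once: [d = false] stands for the left
    side and [d = true] for the right one, where the order is reversed.  Thus
    [side_le d p q] says that [p] is at least as far out as [q] on side [d]; an
    end is the last vertex of the interval on that side, or [None] if the
    interval is unbounded there. *)
Definition side_le (d : bool) (p q : int) : bool := if d then q <= p else p <= q.

Definition inside (d : bool) (a : option int) (k : int) : bool :=
  if a is Some p then side_le d p k else true.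

Section Ends.
Variable o : int -> bool.
Notation Q := (line o).

(** The boundary arrow at the end [p]: the arrow [e] joins [e] and [e + 1]. *)
Definition end_arrow (d : bool) (p : int) : int := if d then p else p - 1.

Definition inward (d : bool) (a : option int) : bool :=
  if a is Some p then o (end_arrow d p) (+) d else false.
Definition outward (d : bool) (a : option int) : bool :=
  if a is Some p then ~~ (o (end_arrow d p) (+) d) else false.

(** [a'] is lower than [a] if [a'] lies beyond [a] across an arrow pointing inward
    (an enhancement) or strictly inside [a] behind an arrow pointing outward (a
    reduction).  From bottom to top, one finds the ends with an outward arrow,
    moving outward; then the infinite end; then the ends with an inward arrow,
    moving inward. *)
Definition end_lt (d : bool) (a' a : option int) : bool :=
  match a', a with
  | Some p', Some p => ~~ side_le d p p' && inward d a || ~~ side_le d p' p && outward d a'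
  | None, _ => inward d a
  | Some _, None => outward d a'
  end.

Lemma end_lt_total d a a' : [\/ end_lt d a a', a = a' | end_lt d a' a].
Proof.
case: a a' => [a|] [a'|]; rewrite /= /side_le.
- case: (ltgtP a a') => [ne|ne|->]; last (by constructor 2);
  case: d => /=; case: (o a); case: (o a'); case: (o (a - 1)); case: (o (a' - 1));
    first [constructor 1; lia | constructor 3; lia].
- by case: (o _ (+) d); [constructor 3|constructor 1].
- by case: (o _ (+) d); [constructor 1|constructor 3].
- by constructor 2.
Qed.

Lemma end_lt_trans d : transitive (end_lt d).
Proof.
(* [lia] takes [o] at equal arrows for unrelated booleans unless told otherwise. *)
have E p q : p = q -> o (end_arrow d p) = o (end_arrow d q) by move->.
move=> [a|] [b|] [c|] //=; rewrite /side_le.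
- move: (E a b) (E b c) (E a c); case: (o _); case: (o _); case: (o _) => /=;
    by case: (d) => /=; lia.
- by move: (E a b); case: (o _); case: (o _) => /=; case: (d) => /=; lia.
- by move: (E a c); case: (o _); case: (o _) => /=; case: (d) => /=; lia.
- by case: (o _ (+) d).
- by move: (E b c); case: (o _); case: (o _) => /=; case: (d) => /=; lia.
Qed.

Lemma end_lt_irr d a : end_lt d a a = false.
Proof. by case: a => [a|] //=; rewrite /side_le; case: d; rewrite lexx. Qed.

(** The two ways of lowering an end, in the form used to compare the families
    attached to them. *)
Lemma end_lt_cases d a' a : end_lt d a' a ->
  (inward d a /\ forall k, inside d a k -> inside d a' k) \/
  (outward d a' /\ forall k, inside d a' k -> inside d a k).
Proof.
case: a' a => [p'|] [p|] //=; last 2 first.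
- by move=> op; right.
- by move=> ip; left.
case/orP => /andP[pp op]; [left|right]; split=> // k; move: pp; rewrite /side_le;
  by case: (d); lia.
Qed.

Lemma outward_src d a (e : qarr Q) :
  outward d a -> inside d a (tgt e) -> inside d a (src e).
Proof.
case: a => [p|] //=; rewrite /src /tgt /= /side_le; move: e => /= e.
have E x y : x = y -> o x = o y by move->.
move: (E (end_arrow d p) e) => {E}; rewrite /end_arrow.
by case: (d) => /=; case: (o e); case: (o _) => //=; lia.
Qed.

Lemma inward_tgt d a (e : qarr Q) :
  ~~ outward d a -> inside d a (src e) -> inside d a (tgt e).
Proof.
case: a => [p|] //=; rewrite /src /tgt /= /side_le; move: e => /= e.
have E x y : x = y -> o x = o y by move->.
move: (E (end_arrow d p) e) => {E}; rewrite /end_arrow.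
by case: (d) => /=; case: (o e); case: (o _) => //=; lia.
Qed.

Hypothesis ho : eventually_outward o.

Lemma eventually_bound : exists N : nat, forall e : int,
  (N%:Z <= e -> o e) /\ (e < - N%:Z -> ~~ o e).
Proof.
case: ho => /finite_seqP[s Hs] /finite_seqP[s' Hs'].
have bnd (t : seq int) : exists N : nat, forall e : int, e \in t -> `|e| < N%:Z.
  elim: t => [|x t [N HN]]; first by exists 0%N.
  exists (maxn N (`|x|%N).+1) => e; rewrite inE => /predU1P[->|/HN]; lia.
have [N HN] := bnd s; have [N' HN'] := bnd s'.
exists (maxn N N') => e; split=> le.
  apply: contraT => noe; have : [set` s] e by rewrite -Hs /=; split=> //; lia.
  by move=> /= /HN; lia.
apply/negP => oe; have : [set` s'] e by rewrite -Hs' /=; split=> //; lia.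
by move=> /= /HN'; lia.
Qed.

Lemma inward_bound d : exists m, forall p, inward d (Some p) -> side_le d m p.
Proof.
have [N HN] := eventually_bound; exists (if d then N%:Z else - N%:Z) => p.
rewrite /= /side_le; case: d => /=; rewrite ?addbT ?addbF => op.
  by case: (HN p) => H _; apply: contraNT op => ?; apply: H; lia.
by case: (HN (p - 1)) => _ H; apply: contraTT op => ?; apply: H; lia.
Qed.

Lemma outward_bound d : exists m, forall p, outward d (Some p) -> side_le d p m.
Proof.
have [N HN] := eventually_bound; exists (if d then - N%:Z else N%:Z) => p.
rewrite /= /side_le; case: d => /=; rewrite ?addbT ?addbF ?negbK => op.
  by case: (HN p) => _ H; apply: contraTT op => ?; apply: H; lia.
by case: (HN (p - 1)) => H _; apply: contraNT op => ?; apply: H; lia.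
Qed.

(** Ends with an outward arrow cannot lie arbitrarily far inward, nor ends with an
    inward arrow arbitrarily far outward; this bounds the two infinite parts of
    the order from below, each by a distance to a fixed vertex. *)
Lemma end_lt_wf d : well_founded (end_lt d).
Proof.
have [m Hm] := inward_bound d; have [M HM] := outward_bound d.
have out p : outward d (Some p) -> Acc (end_lt d) (Some p).
  have [n] := ubnP `|M - p|%N; elim: n => [|n IH] in p *; first by rewrite ltn0.
  move=> np op; constructor => -[q|] /=; last first.
    by move: op => /=; case: (_ (+) _).
  have := HM p op; move: op => /= /negPf->; rewrite andbF /= => Mp /andP[qp oq].
  apply: IH => //; have := HM q oq; move: np qp Mp.
  by rewrite /side_le; case: (d); lia.
have none : Acc (end_lt d) None by constructor => -[q oq|]; [apply: out | ].
have inw p : inward d (Some p) -> Acc (end_lt d) (Some p).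
  have [n] := ubnP `|p - m|%N; elim: n => [|n IH] in p *; first by rewrite ltn0.
  move=> np ip; constructor => -[q|]; last by move=> _; exact: none.
  case: (boolP (outward d (Some q))) => oq; first by move=> _; apply: out.
  have {oq}iq : inward d (Some q) by move: oq => /=; rewrite negbK.
  have := Hm p ip; move: (ip) (iq) => /= -> ->; rewrite andbF orbF andbT => mp qp.
  apply: IH => //; have := Hm q iq; move: np qp mp.
  by rewrite /side_le; case: (d); lia.
case=> [p|]; last exact: none.
by case: (boolP (inward d (Some p))) => ip; [exact: inw | exact: out].
Qed.

End Ends.

(** * Intervals, boundary arrows, reductions and enhancements *)

Section Geometry.
Variable o : int -> bool.
Notation Q := (line o).

(** The side of [e] on which its target lies, in coordinates. *)
Definition front (e k : int) : bool := if o e then e + 1 <= k else k <= e.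

Lemma front_tgt (e : qarr Q) : front e (tgt e).
Proof. by rewrite /front /tgt /=; case: (o e); lia. Qed.

Lemma front_src (e : qarr Q) : front e (src e) = false.
Proof. by rewrite /front /src /=; case: (o e); lia. Qed.

(** Only [e] itself crosses from one side of [e] to the other. *)
Lemma front_cross (e e' : qarr Q) : e' != e -> front e (src e') = front e (tgt e').
Proof.
rewrite /front /tgt /src /=; move: e e' => /= e e' ne.
by case: (o e); case: (o e'); lia.
Qed.

Lemma walk_arrs_verts i j (w : @walk Q i j) e : e \in walk_arrs w ->
  src e \in walk_verts w /\ tgt e \in walk_verts w.
Proof.
elim: w => [|f w IH|f w IH] //=; rewrite inE => /predU1P[->|/IH[sw tw]];
  by rewrite !inE ?sw ?tw ?eqxx ?orbT //= ?walk_end ?orbT.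
Qed.

Lemma front_walk (e : qarr Q) i j (w : @walk Q i j) :
  e \notin walk_arrs w -> front e i = front e j.
Proof.
elim: w => [|f w IH|f w IH] //=; rewrite inE negb_or eq_sym => /andP[fe /IH->].
  exact: front_cross.
by rewrite front_cross.
Qed.

Lemma walk_avoid (e : qarr Q) i j : front e i = front e j ->
  exists w : @walk Q i j, e \notin walk_arrs w.
Proof.
move=> fij; have [w wi] := line_walk_exists o i j; exists w.
apply/negP => /walk_arrs_verts[/(line_walk_inj_btw wi) sw /(line_walk_inj_btw wi) tw].
move: fij sw tw; rewrite /front /btw /src /tgt /=.
by move: i j e {w wi} => /= i j e; case: (o e); lia.
Qed.

Lemma in_frontE (e : qarr Q) i : in_front e i <-> front e i.
Proof.
split=> [[w /front_walk]|fi]; first by rewrite front_tgt => <-.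
by have [|w we] := @walk_avoid e (tgt e) i; [rewrite front_tgt fi | exists w].
Qed.

Lemma behindE (e : qarr Q) i : behind e i <-> ~~ front e i.
Proof.
split=> [[w /front_walk]|/negPf fi]; first by rewrite front_src => <-.
by have [|w we] := @walk_avoid e (src e) i; [rewrite front_src fi | exists w].
Qed.

Definition ends := bool -> option int.

Definition between (E : ends) (k : int) : Prop := forall d, inside d (E d) k.

Definition is_ends (E : ends) (a : set int) : Prop := forall k, a k <-> between E k.

Definition set_end (d : bool) (x : option int) (E : ends) : ends :=
  fun d' => if d' == d then x else E d'.

Lemma betweenE d E k : between E k <-> inside d (E d) k /\ inside (~~ d) (E (~~ d)) k.
Proof.
split=> [H|[H H'] d']; first by split; apply: H.
by case: d d' H H' => [] [].
Qed.

Lemma between_set d x E k :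
  between (set_end d x E) k <-> inside d x k /\ inside (~~ d) (E (~~ d)) k.
Proof. by rewrite (betweenE d) /set_end eqxx eqb_negLR /= eq_sym; case: d. Qed.

Lemma between_btw E i j k : between E i -> between E j -> btw i k j -> between E k.
Proof.
move=> Ei Ej ikj d; move: (Ei d) (Ej d) ikj.
by rewrite /inside /btw /side_le; case: (E d) => // p; case: d; lia.
Qed.

Fact between_connected E i j : between E i -> between E j ->
  exists w : @walk Q i j, forall k, k \in walk_verts w -> between E k.
Proof.
move=> Ei Ej; have [w wi] := line_walk_exists o i j; exists w => k.
by move/(line_walk_inj_btw wi); apply: between_btw.
Qed.

Definition interval_csub (E : ends) (hE : between E !=set0) : csubquiver Q :=
  @CSubquiver Q (between E) hE (@between_connected E).

Lemma interval_csub_ends E hE : is_ends E (@interval_csub E hE).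
Proof. by []. Qed.

Lemma csub_convex (a : csubquiver Q) (i j k : int) :
  sq_verts a i -> sq_verts a j -> btw i k j -> sq_verts a k.
Proof. by move=> ai aj ikj; have [w wa] := sq_connected ai aj; apply/wa/line_walk_btw. Qed.

(** Connected subquivers are convex, so on each side of a chosen vertex membership
    stops at the first vertex outside, if there is one. *)
Lemma csub_ends (a : csubquiver Q) : exists E, is_ends E a.
Proof.
have [i ai] := sq_nonempty a.
have cv := @csub_convex a i; move: i ai cv => /= i ai cv.
have side d : exists x, inside d x i /\
    forall k, side_le d k i -> (sq_verts a k <-> inside d x k).
  pose nth (n : nat) : int := if d then i + n%:Z else i - n%:Z.
  have [[n an]|all_a] := pselect (exists n, ~ sq_verts a (nth n)); last first.
    exists None; split=> // k ki; split=> // _.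
    apply: contrapT => ak; apply: all_a; exists `|i - k|%N.
    by move: ki ak; rewrite /nth /side_le; case: d {nth} => ki; congr (~ sq_verts a _); lia.
  have exn : exists n, `[< ~ sq_verts a (nth n) >] by exists n; apply/asboolP.
  case: (ex_minnP exn) => m /asboolP am mmin.
  have m0 : (0 < m)%N.
    by case: m am {mmin} => //; rewrite /nth; case: d {nth exn an}; rewrite ?addr0 ?subr0.
  exists (Some (nth m.-1)); split.
    by rewrite /= /side_le /nth; case: d {nth exn an am mmin}; lia.
  move=> k ki; pose q := `|i - k|%N; have kq : k = nth q.
    by move: ki; rewrite /nth /side_le /q; case: (d); lia.
  have -> : inside d (Some (nth m.-1)) k = (q < m)%N.
    by rewrite kq /= /nth /side_le; case: (d); lia.
  rewrite kq; split=> [aq|qm].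
    rewrite ltnNge; apply/negP => mq; apply: am; apply: (cv (nth q)) => //.
    by rewrite /nth /btw; case: (d); lia.
  by apply: contrapT => /asboolP /mmin; lia.
have [E HE] := choice side; exists E => k; split=> [ak d|Ek].
  have [Ei HEd] := HE d; case: (boolP (side_le d k i)) => ki; first exact/HEd.
  by move: Ei ki; rewrite /inside /side_le; case: (E d) => // p; case: (d); lia.
case: (lerP k i) => ki; first by have [_ ->] := HE false.
by have [_ ->] := HE true; rewrite // /side_le ltW.
Qed.

Lemma ibaP E (a : csubquiver Q) e : is_ends E a ->
  iba a e <-> exists d p, [/\ E d = Some p, e = end_arrow d p & inward o d (Some p)].
Proof.
move=> aE; have [i ai] := sq_nonempty a; split.
  move=> [ba af].
  have [st tt] : ~ sq_verts a (src e) /\ sq_verts a (tgt e).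
    case: ba => // -[/af/in_frontE]; by rewrite front_src.
  have [d nd] : exists d, ~ inside d (E d) (src e).
    by apply: contra_notP st => H; apply/aE => d; apply: contrapT => nd; apply: H; exists d.
  exists d; move: nd (proj1 (aE _) tt d); case: (E d) => // p np pt; exists p.
  move: np pt; rewrite /end_arrow /= /end_arrow /side_le /src /tgt /=; move: e {ba af st tt} => /= e.
  case: (d) => //= np pt.
    have -> : p = e by move: np pt; case: (o e); lia.
    by split=> //; move: np pt; case: (o e); lia.
  have -> : p = e + 1 by move: np pt; case: (o e); lia.
  by rewrite addrK; split=> //; move: np pt; case: (o e); lia.
move=> [d [p [Ed -> ip]]].
have E2 : sq_verts a p.
  apply/aE/(betweenE d); rewrite Ed /= /side_le; split; first by case: (d).
  have := proj1 (aE _) ai; rewrite (betweenE d) Ed /= /side_le.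
  by case: (E _) => //= q; rewrite /side_le; case: (d); move: i {ai} => /= i; lia.
have [sp tp] : ~ sq_verts a (src (end_arrow d p : qarr Q)) /\ tgt (end_arrow d p : qarr Q) = p.
  split.
    move=> /aE /(_ d); rewrite Ed; move: ip; rewrite /= /side_le /src /=.
    by case: (d) => /=; case: (o _) => //=; lia.
  by move: ip; rewrite /= /tgt /=; case: (d) => /=; case: (o _) => //=; lia.
split; first by right; rewrite tp.
move=> k /aE /(_ d); rewrite in_frontE Ed /front; move: ip; rewrite /= /side_le.
by move: k; case: (d) => /= k; case: (o _) => //=; lia.
Qed.

Lemma obaP E (a : csubquiver Q) e : is_ends E a ->
  oba a e <-> exists d p, [/\ E d = Some p, e = end_arrow d p & outward o d (Some p)].
Proof.
move=> aE; have [i ai] := sq_nonempty a; split.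
  move=> [ba af].
  have [st tt] : sq_verts a (src e) /\ ~ sq_verts a (tgt e).
    case: ba => // -[_ /af/behindE]; by rewrite front_tgt.
  have [d nd] : exists d, ~ inside d (E d) (tgt e).
    by apply: contra_notP tt => H; apply/aE => d; apply: contrapT => nd; apply: H; exists d.
  exists d; move: nd (proj1 (aE _) st d); case: (E d) => // p np pt; exists p.
  move: np pt; rewrite /end_arrow /= /end_arrow /side_le /src /tgt /=; move: e {ba af st tt} => /= e.
  case: (d) => //= np pt.
    have -> : p = e by move: np pt; case: (o e); lia.
    by split=> //; move: np pt; case: (o e); lia.
  have -> : p = e + 1 by move: np pt; case: (o e); lia.
  by rewrite addrK; split=> //; move: np pt; case: (o e); lia.
move=> [d [p [Ed -> ip]]].
have E2 : sq_verts a p.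
  apply/aE/(betweenE d); rewrite Ed /= /side_le; split; first by case: (d).
  have := proj1 (aE _) ai; rewrite (betweenE d) Ed /= /side_le.
  by case: (E _) => //= q; rewrite /side_le; case: (d); move: i {ai} => /= i; lia.
have [sp tp] : ~ sq_verts a (tgt (end_arrow d p : qarr Q)) /\ src (end_arrow d p : qarr Q) = p.
  split.
    move=> /aE /(_ d); rewrite Ed; move: ip; rewrite /= /side_le /tgt /=.
    by case: (d) => /=; case: (o _) => //=; lia.
  by move: ip; rewrite /= /src /=; case: (d) => /=; case: (o _) => //=; lia.
split; first by left; rewrite tp.
move=> k /aE /(_ d); rewrite behindE Ed /front; move: ip; rewrite /= /side_le.
by move: k; case: (d) => /= k; case: (o _) => //=; lia.
Qed.

(** A reduction at [e] replaces the end on the target side of [e] by [src e]; an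
    enhancement at [e] moves outward an end that was [tgt e]. *)
Lemma step_ends E (a b : csubquiver Q) : is_ends E a -> reduction a b \/ enhancement a b ->
  exists d x, end_lt o d x (E d) /\ is_ends (set_end d x E) b.
Proof.
move=> aE [[e [sa ta] bE]|[e [sb tb] aE']].
  have be k : sq_verts b k <-> sq_verts a k /\ ~~ front e k.
    by rewrite bE; split=> -[ak] /behindE.
  exists (o e), (Some (src e)); split.
    move: (proj1 (aE _) sa (o e)) (proj1 (aE _) ta (o e)); rewrite /src /tgt /=.
    case: (E _) => [p|] /=; rewrite /side_le /end_arrow; case oe: (o e) => //=.
    - by rewrite oe /=; lia.
    - by rewrite addrK oe orbC /=; lia.
    - by rewrite oe.
    - by rewrite addrK oe.
  move=> k; rewrite be between_set aE (betweenE (o e)).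
  move: (proj1 (aE _) sa (o e)); rewrite /front /src /= /side_le.
  by case: (E (o e)) => [p|] /=; rewrite /side_le; case: (o e) => /=; move: k => /= k;
    case: (inside _ _ k); lia.
have be k : sq_verts a k <-> sq_verts b k /\ front e k.
  by rewrite aE'; split=> -[ak] /in_frontE.
have [E' bE] := csub_ends b.
have ae : ~ sq_verts a (src e) by rewrite be front_src => -[].
have ta : sq_verts a (tgt e) by rewrite be front_tgt.
have Ed : E (~~ o e) = Some (tgt e : int).
  move: (proj1 (aE _) ta); rewrite (betweenE (~~ o e)) negbK => -[tf tb'].
  have : ~ inside (~~ o e) (E (~~ o e)) (src e).
    apply: contra_not ae => si; apply/aE; rewrite (betweenE (~~ o e)) negbK; split=> //.
    move: tb'; rewrite /src /tgt /=; case: (E (o e)) => //= p; rewrite /side_le.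
    by case: (o e) => /=; move: e {sb tb aE' be ta tf si} => /= e; lia.
  move: tf; rewrite /src /tgt /=; case: (E (~~ o e)) => //= p; rewrite /side_le.
  by case: (o e) => /= tp sp; congr Some; move: e tp sp {sb tb aE' be ta tb' ae} => /= e; lia.
exists (~~ o e), (E' (~~ o e)); split.
  move: (proj1 (bE _) sb (~~ o e)); rewrite Ed /src /tgt /=.
  case: (E' _) => [q|] /=; rewrite /side_le /end_arrow; case oe: (o e) => //=.
  - by rewrite addrK oe /=; lia.
  - by rewrite oe /=; lia.
  - by rewrite addrK oe.
  - by rewrite oe.
move=> k; rewrite between_set negbK.
have t2 : inside (o e) (E (o e)) (tgt e) by have := proj1 (aE _) ta (o e).
have s2 : inside (o e) (E' (o e)) (src e) by have := proj1 (bE _) sb (o e).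
have s1 : inside (~~ o e) (E' (~~ o e)) (src e) by have := proj1 (bE _) sb (~~ o e).
case: (boolP (front e k)) => fk.
  have ab : sq_verts b k <-> sq_verts a k by rewrite be; split=> // -[].
  have Ek : inside (~~ o e) (E (~~ o e)) k.
    by rewrite Ed /tgt /=; move: fk; rewrite /front /side_le; case: (o e).
  rewrite ab aE (betweenE (~~ o e)) negbK; split=> -[H1 H2]; split=> //.
  move: s1 fk; rewrite /front /src /=; case: (E' _) => //= q; rewrite /side_le.
  by case: (o e) => /=; move: e k {sb tb aE' be ae ta Ed s2 t2 ab Ek H1 H2} => /= e k; lia.
rewrite bE (betweenE (~~ o e)) negbK; split=> -[H1 H2]; split=> //.
  move: t2 fk; rewrite /front /tgt /=; case: (E _) => //= q; rewrite /side_le.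
  by case: (o e) => /=; move: e k {sb tb aE' be ae ta Ed s1 s2 H1 H2} => /= e k; lia.
move: s2 fk; rewrite /front /src /=; case: (E' _) => //= q; rewrite /side_le.
by case: (o e) => /=; move: e k {sb tb aE' be ae ta Ed s1 t2 H1 H2} => /= e k; lia.
Qed.

(** Conversely, lowering an end is a reduction if the new end is still inside, at
    the arrow just outside the new end, and an enhancement otherwise, at the arrow
    just outside the old one. *)
Lemma ends_step E d x (a b : csubquiver Q) : is_ends E a -> is_ends (set_end d x E) b ->
  end_lt o d x (E d) -> reduction a b \/ enhancement a b.
Proof.
move=> aE bE; have [i ai] := sq_nonempty a; have [j bj] := sq_nonempty b.
move: (proj1 (aE _) ai) (proj1 (bE _) bj); rewrite between_set (betweenE d).
move=> [i1 i2] [j1 j2].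
case: (boolP (if x is Some q then inside d (E d) q else false)) => ox lt.
  left; case: x bE lt ox j1 => // x bE lt xin xj.
  have ox : outward o d (Some x).
    by move: lt xin; case: (E d) => [p|] /=; [move=> + px; rewrite px /=; case/andP | ].
  have E1 : inside d (E d) x /\ inside d (E d) (if d then x + 1 else x - 1).
    move: ox lt xin; case: (E d) => [p|] //=; rewrite /side_le /end_arrow.
    by case: (d) => /=; case: (o _) => //= _; rewrite ?andbF ?andbT ?orbF; lia.
  have E2 : inside (~~ d) (E (~~ d)) x /\ inside (~~ d) (E (~~ d)) (if d then x + 1 else x - 1).
    move: xj j2; rewrite /=; case: (E (~~ d)) => [p|] //=; rewrite /side_le.
    by case: (d) => /=; move: j {bj} => /= j; lia.
  exists (end_arrow d x).
    move: ox E1 E2; rewrite /arrow_in !aE !(betweenE d) /src /tgt /= /end_arrow.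
    by case: (d); case: (o _) => //= _ [] ? ? []; rewrite ?subrK.
  apply/seteqP; split=> k /=.
    rewrite bE between_set behindE aE (betweenE d) => -[H1 H2].
    split.
      split=> //; move: H1 (E1.1) ; case: (E d) => //= p; rewrite /side_le.
      by case: (d); move: k {H2} => /= k; lia.
    by move: H1 ox; rewrite /= /side_le /front; case: (d); case: (o _) => //= ; move: k {H2} => /= k; lia.
  rewrite bE between_set behindE aE (betweenE d) => -[[H1 H2] fk]; split=> //.
  move: fk ox; rewrite /= /side_le /front.
  by case: (d); case: (o _) => //=; move: k {H1 H2} => /= k; lia.
right.
have [p Ed ip] : exists2 p, E d = Some p & inward o d (Some p).
  move: lt ox; case: (E d) x {bE j1} => [p|] [x|] //=.
    by case/orP => [/andP[_ op]|/andP[+ _] npx] //; [exists p | move: npx; rewrite /side_le; case: (d); lia].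
  by exists p.
have {}lt : ~~ inside d (Some p) (if x is Some q then q else p) || (x == None).
  by move: ox; rewrite Ed; case: x {bE j1 lt} => [x|] //=; rewrite ?orbT // orbF.
have E1 : inside d x p /\ inside d x (if d then p + 1 else p - 1).
  by move: lt; case: x {bE j1 ox} => [x|] //=; rewrite orbF /side_le; case: (d); lia.
rewrite Ed in i1.
have E2 : inside (~~ d) (E (~~ d)) p /\ inside (~~ d) (E (~~ d)) (if d then p + 1 else p - 1).
  move: i1 i2; rewrite /=; case: (E (~~ d)) => [q|] //=; rewrite /side_le.
  by case: (d) => /=; move: i {ai} => /= i; lia.
exists (end_arrow d p).
  move: ip E1 E2; rewrite /arrow_in !bE !between_set /src /tgt /= /end_arrow.
  by case: (d); case: (o _) => //= _ [] ? ? []; rewrite ?subrK.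
apply/seteqP; split=> k /=.
  rewrite bE between_set in_frontE aE (betweenE d) Ed => -[H1 H2]; split.
    split=> //; move: H1 (E1.1) ; case: x {bE j1 ox lt E1} => //= q; rewrite /side_le.
    by case: (d); move: k {H2} => /= k; lia.
  by move: H1 ip; rewrite /= /side_le /front; case: (d); case: (o _) => //= ; move: k {H2} => /= k; lia.
rewrite bE between_set in_frontE aE (betweenE d) Ed => -[[H1 H2] fk]; split=> //.
move: fk ip; rewrite /= /side_le /front.
by case: (d); case: (o _) => //=; move: k {H1 H2} => /= k; lia.
Qed.

End Geometry.

(** * Families compatible with the arrows *)

Section Sections.
Variables (F : fieldType) (o : int -> bool) (V : rep F (line o)).
Notation Q := (line o).
Notation M := (family (rep_sp V)).
Implicit Types (z w : M) (e : qarr Q) (i j k : qvert Q).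

Definition compat z e : Prop := rep_map V e (z (src e)) = z (tgt e).

Lemma compat_lin a z w e : compat z e -> compat w e -> compat (a *: z + w) e.
Proof. by rewrite /compat !family_linE linearP => -> ->. Qed.

Lemma compat_eq z w e : z (src e) = w (src e) -> z (tgt e) = w (tgt e) ->
  compat w e -> compat z e.
Proof. by rewrite /compat => -> ->. Qed.

(** Following a walk and taking images or preimages is the same as asking for
    intermediate vectors.  An injective walk never returns to a vertex, so a
    family built for an initial part can be changed at the next vertex freely. *)
Lemma walk_transportP i j (w : walk i j) (U : set (V i)) (x : V j) : walk_inj w ->
  walk_transport w U x <->
  exists z, [/\ U (z i), z j = x & forall e, e \in walk_arrs w -> compat z e].
Proof.
rewrite /walk_inj; elim: w x => [|e w IH|e w IH] x /=.
- move=> _; split=> [Ux|[z [Uz <- _]]] //.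
  by exists (dfwith (0 : M) x); rewrite dfwith_in.
- case/andP=> tw uw; split=> [[y /(IH _ uw)[z [Uz zy zc]] <-]|[z [Uz <- zc]]]; last first.
    exists (z (src e)); last by apply: zc; rewrite inE eqxx.
    by apply/(IH _ uw); exists z; split=> // e' e'w; apply: zc; rewrite inE e'w orbT.
  have old k : k \in walk_verts w -> dfwith z (rep_map V e y) k = z k.
    by move=> kw; apply: dfwith_out; apply: contraNneq tw => ->.
  exists (dfwith z (rep_map V e y)); split.
  + by rewrite old ?walk_start.
  + by rewrite dfwith_in.
  move=> e'; rewrite inE => /predU1P[->|e'w].
    by rewrite /compat dfwith_in old ?walk_end // zy.
  by have [sw tw'] := walk_arrs_verts e'w; apply: compat_eq (zc _ e'w); rewrite old.
- case/andP=> tw uw; split=> [/(IH _ uw)[z [Uz zy zc]]|[z [Uz <- zc]]]; last first.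
    apply/(IH _ uw); exists z; split=> //; first by rewrite -zc // inE eqxx.
    by move=> e' e'w; apply: zc; rewrite inE e'w orbT.
  have old k : k \in walk_verts w -> dfwith z x k = z k.
    by move=> kw; apply: dfwith_out; apply: contraNneq tw => ->.
  exists (dfwith z x); split.
  + by rewrite old ?walk_start.
  + by rewrite dfwith_in.
  move=> e'; rewrite inE => /predU1P[->|e'w].
    by rewrite /compat dfwith_in old ?walk_end // zy.
  by have [sw tw'] := walk_arrs_verts e'w; apply: compat_eq (zc _ e'w); rewrite old.
Qed.

Lemma btw_walk_arrs i j (w : walk i j) e :
  btw i (src e) j -> btw i (tgt e) j -> e \in walk_arrs w.
Proof.
move=> sb tb; apply: contraT => /front_walk; move: sb tb.
rewrite /front /src /tgt /= /btw; move: i j e {w} => /= i j e.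
by case: (o e); lia.
Qed.

Lemma transportP i j (U : set (V i)) (x : V j) : transport V i j U x <->
  exists z, [/\ U (z i), z j = x &
    forall e, btw i (src e) j -> btw i (tgt e) j -> compat z e].
Proof.
split=> [|[z [Uz zx zc]] w wi].
  have [w wi] := line_walk_exists o i j => /(_ w wi) /(walk_transportP _ _ wi)[z [Uz zx zc]].
  by exists z; split=> // e sb tb; apply/zc/btw_walk_arrs.
apply/(walk_transportP _ _ wi); exists z; split=> // e /walk_arrs_verts[sw tw].
by apply: zc; apply: (line_walk_inj_btw wi).
Qed.

Lemma glue_families d j z w : w j = z j -> exists z',
  (forall k, side_le d k j -> z' k = w k) /\ (forall k, side_le d j k -> z' k = z k).
Proof.
move=> wz; exists (fun k => if side_le d k j then w k else z k); split=> k.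
  by move=> ->.
case: ifP => // kj jk; have -> : k = j; last by [].
by move: kj jk; rewrite /side_le; case: d; move: j k {wz} => /= j k; lia.
Qed.

(** Families satisfying, on the outer side of [i], the conditions for a
    homomorphism from the interval module.  An inward boundary arrow has its
    source outside, so nothing is asked beyond it; this is why the values beyond
    the end matter only when the boundary arrow points outward. *)
Definition side_section d (a : option int) i : set M := [set z |
  (forall e, side_le d (src e) i -> side_le d (tgt e) i -> inside d a (src e) -> compat z e) /\
  (outward o d a -> forall k, ~~ inside d a k -> z k = 0)].

Definition side_space d a i : set (V i) := [set y | exists2 z, side_section d a i z & z i = y].
Arguments side_space : clear implicits.

Lemma side_space_closed d a i : lin_closed (side_space d a i).
Proof.
split.
  exists 0 => //; split=> // e _ _ _.
  by rewrite /compat; exact: (linear0 (rep_map V e)).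
move=> c _ _ [z [zc z0] <-] [w [wc w0] <-]; exists (c *: z + w) => //; split.
  by move=> e sb tb ea; apply: compat_lin; [apply: zc | apply: wc].
by move=> oa k ka; rewrite family_linE z0 // w0 // scaler0 addr0.
Qed.

(** The same family serves for both ends: when the boundary arrow of [a'] points
    outward, the family vanishes beyond [a'] and no arrow enters the inside of
    [a'] from there, so it is also compatible up to [a]. *)
Lemma side_space_mono d a' a i : end_lt o d a' a -> side_space d a' i `<=` side_space d a i.
Proof.
move=> lt y [z [zc z0] <-]; exists z => //.
have [[ia sub]|[oa sub]] := end_lt_cases lt.
  split; first by move=> e sb tb /sub; apply: zc.
  by case: (a) ia => //= p ->.
split=> [e sb tb ea|_ k ka].
  have [ea'|nea'] := boolP (inside d a' (src e)); first exact: zc.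
  rewrite /compat (z0 oa) // (z0 oa) ?linear0 //.
  by apply: contra nea'; apply: outward_src.
by apply: (z0 oa); apply: contra ka; apply: sub.
Qed.

Definition outer_vertex d (i : int) (n : nat) : int := if d then i + n%:Z else i - n%:Z.

Section Extension.
Variables (d : bool) (i : qvert Q) (y : V i).

(** [extend n] is reliable up to distance [n] from [i]: each step pushes the last
    vector along the next arrow if that arrow points away from [i]. *)
Fixpoint extend (n : nat) : M :=
  if n is n'.+1 then
    let e : qarr Q := end_arrow d (outer_vertex d i n') in
    if side_le d (tgt e) (src e) then dfwith (extend n') (rep_map V e (extend n' (src e)))
    else extend n'
  else dfwith (0 : M) y.

Lemma extend_step n e : e = end_arrow d (outer_vertex d i n) -> side_le d (tgt e) (src e) ->
  extend n.+1 (tgt e) = rep_map V e (extend n (src e)).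
Proof. by move=> -> /= ->; rewrite dfwith_in. Qed.

(** The value at distance [n] is read off from [extend n], whence a family on the
    whole side, possibly infinite. *)
Lemma extension a :
  (forall e, side_le d (src e) i -> side_le d (tgt e) i -> inside d a (src e) ->
    side_le d (tgt e) (src e)) ->
  inside d a i -> ~~ outward o d a -> side_space d a i y.
Proof.
move=> out ia oa; exists (fun k => extend `|(i : int) - k|%N k); last first.
  by rewrite subrr /= dfwith_in.
split; last by rewrite (negPf oa).
move=> e sb tb /(out e sb tb) ts; pose n := `|(i : int) - src e|%N.
have sn : src e = outer_vertex d i n.
  by move: sb; rewrite /side_le /outer_vertex /n; case: (d); move: (i) (src e) => /= j k; lia.
have [en tn] : e = end_arrow d (outer_vertex d i n) /\ tgt e = outer_vertex d i n.+1.
  move: sn ts {tb}; rewrite /end_arrow /outer_vertex /side_le; move: n => n; rewrite /src /tgt /=.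
  by case: (d); move: (i) (e) => /= j f; case: (o f); lia.
have tE : `|(i : int) - tgt e|%N = n.+1 by rewrite tn /outer_vertex; case: (d); lia.
by rewrite /compat tE extend_step.
Qed.

End Extension.

(** The end in question is the nearest one, going outward from [i], whose boundary
    arrow points inward: before it, all arrows point away from [i]. *)
Lemma side_space_full d i : exists a, inside d a i /\ forall y, side_space d a i y.
Proof.
pose at_ n := inward o d (Some (outer_vertex d i n)).
have inw e : side_le d (tgt e) i -> ~~ side_le d (tgt e) (src e) ->
    at_ `|(i : int) - tgt e|%N /\ ~~ side_le d (outer_vertex d i `|(i : int) - tgt e|%N) (src e).
  move=> tb; have -> : outer_vertex d i `|(i : int) - tgt e|%N = tgt e.
    by move: tb; rewrite /side_le /outer_vertex; case: (d); move: (i) (tgt e) => /= j k; lia.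
  move=> ts; split=> //; rewrite /at_.
  have -> : outer_vertex d i `|(i : int) - tgt e|%N = tgt e.
    by move: tb; rewrite /side_le /outer_vertex; case: (d); move: (i) (tgt e) => /= j k; lia.
  move: ts; rewrite /= /side_le /end_arrow /src /tgt /=; move: (e) => /= f.
  by case: (d); case of_: (o f); rewrite ?addrK ?of_ //; lia.
have [exn|nex] := pselect (exists n, at_ n).
  case: (ex_minnP exn) => m am mmin; exists (Some (outer_vertex d i m)).
  have mi : side_le d (outer_vertex d i m) i by rewrite /side_le /outer_vertex; case: (d); move: (i) => /= j; lia.
  split=> // y; apply: extension => //; last by move: am; rewrite /at_ /= => ->.
  move=> e sb tb ms; apply: contraT => /(inw e tb)[/mmin mn].
  apply: contraNT => _; move: ms mn; rewrite /= /side_le /outer_vertex.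
  by case: (d); move: (i) (src e) (tgt e) => /= j k l; lia.
exists None; split=> // y; apply: extension => // e sb tb _.
by apply: contraT => /(inw e tb)[at_n _]; case: nex; exists `|(i : int) - tgt e|%N.
Qed.

End Sections.
Arguments side_space {F o} V d a i _.

(** * The filtration in terms of families *)

Section Constraints.
Variables (F : fieldType) (o : int -> bool) (V : rep F (line o)).
Notation Q := (line o).
Notation M := (family (rep_sp V)).
Implicit Types (z w : M) (e : qarr Q) (i j k : qvert Q).

(** All arrows on side [d] of [j] point away from [j]: the place of a virtual
    arrow starting at [j]. *)
Definition ray d j : Prop :=
  forall e, side_le d (src e) j -> side_le d (tgt e) j -> side_le d (tgt e) (src e).

(** An injective path on the line never turns back. *)
Lemma varrow_shape (A : varrow Q) : exists d,
  (forall k, va_set A k <-> side_le d k (va_vert A 0)) /\ ray d (va_vert A 0).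
Proof.
have [v [vA adjv nret]] : exists v : nat -> int, [/\ forall n, va_vert A n = v n,
    forall n, v n.+1 = v n + 1 \/ v n.+1 = v n - 1 & forall n, v n.+2 <> v n].
  exists (va_vert A); split=> // n; last by move/(@va_inj _ A); lia.
  rewrite -va_tgt -[va_vert A n]va_src /src /tgt /=.
  by case: (o _); [left|right; rewrite addrK].
have [d step] : exists d, forall n, v n.+1 = if d then v n + 1 else v n - 1.
  exists (v 1%N == v 0%N + 1); elim=> [|n IH].
    by case: eqP => // ?; case: (adjv 0%N).
  by have := adjv n.+1; have := nret n; rewrite IH; case: eqP; lia.
have vE n : v n = outer_vertex d (v 0%N) n.
  elim: n => [|n IH]; first by rewrite /outer_vertex; case: (d); rewrite ?addr0 ?subr0.
  by rewrite step IH /outer_vertex; case: (d); lia.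
have setE k : va_set A k <-> side_le d k (v 0%N).
  split=> [[n _ <-]|kv].
    by rewrite vA vE /outer_vertex /side_le; case: (d) => /=; lia.
  exists `|(k : int) - v 0%N|%N => //; rewrite vA vE /outer_vertex; move: kv; rewrite /side_le.
  by case: (d) => /=; move: k => /= k; lia.
rewrite vA; exists d; split=> // e sv /setE[n _ te]; apply: contraT => ts.
have := va_src A n; have := va_tgt A n; rewrite !vA step.
move: te ts; rewrite vA /src /tgt /side_le /=.
have E x y : x = y -> o x = o y by move->.
move: (va_arr A n) e {sv} => /= f e; move: (E e f) => {}E.
by case: (d) => /=; move: E; case: (o f); case: (o e) => /=; lia.
Qed.

Lemma ray_varrow d j : ray d j ->
  exists A : varrow Q, forall k, va_set A k <-> side_le d k j.
Proof.
move=> rj; pose v (n : nat) : qvert Q := outer_vertex d j n.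
pose a (n : nat) : qarr Q := end_arrow d (outer_vertex d j n).
have [sa ta] : (forall n, src (a n) = v n) /\ (forall n, tgt (a n) = v n.+1).
  split=> n; have := rj (a n); rewrite /a /v /src /tgt /= /end_arrow /outer_vertex /side_le;
  by move: (j) => /= i; case: (d) => /=; case: (o _); lia.
have vi : injective v by move=> m n; rewrite /v /outer_vertex; case: (d); lia.
exists (VArrow sa ta vi) => k; split=> [[n _ <-]|kj] /=.
  by rewrite /v /outer_vertex /side_le; case: (d) => /=; lia.
exists `|(k : int) - j|%N => //=; move: kj; rewrite /v /outer_vertex /side_le.
by case: (d) => /=; move: (j) k => /= i k; lia.
Qed.

Lemma extension_ray d j y : ray d j -> side_space V d None j y.
Proof. by move=> rj; apply: extension => // e sb tb _; apply: rj. Qed.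

Lemma arrow_plus_side d p i x : inward o d (Some p) ->
  arrow_plus V (end_arrow d p) i x <-> side_space V d (Some p) i x.
Proof.
set e : qarr Q := end_arrow d p => ip.
have tp : tgt e = p.
  by move: ip; rewrite /tgt /= /e /end_arrow; case: (d) => /=; case: (o _) => //=; lia.
have fE k : front o e k = side_le d p k.
  by move: ip; rewrite /front /= /e /end_arrow /side_le; move: k; case: (d) => /= k; case: (o _) => //=; lia.
rewrite /arrow_plus; case: asboolP => [/behindE|].
  rewrite fE => npi; split=> // _.
  exists (dfwith (0 : M) x); last by rewrite dfwith_in.
  split; last by move: ip => /= ->.
  move=> f sb tb pf; case/negP: npi; move: sb pf; rewrite /= /side_le.
  by case: (d); move: (i) (src f) => /= k l; lia.
move=> /behindE/negP; rewrite negbK fE => pi.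
have btwE k : btw (tgt e) k i = side_le d p k && side_le d k i.
  by move: pi; rewrite tp /btw /side_le; case: (d); move: (i) k => /= l k; lia.
split=> [/transportP[z [_ <- zc]]|[z [zc _] <-]].
  exists z => //; split; last by move: ip => /= ->.
  move=> f sb tb pf; apply: zc; rewrite btwE ?sb ?tb ?andbT //.
  by apply: (@inward_tgt o d (Some p)) => //; move: ip => /= ->.
by apply/transportP; exists z; split=> // f; rewrite !btwE => /andP[ps si] /andP[pt ti]; apply: zc.
Qed.

Lemma arrow_minus_side d p i x : outward o d (Some p) ->
  arrow_minus V (end_arrow d p) i x <-> side_space V d (Some p) i x.
Proof.
set e : qarr Q := end_arrow d p => op.
have tp : ~~ side_le d p (tgt e).
  by move: op; rewrite /tgt /= /e /end_arrow /side_le; case: (d) => /=; case: (o _) => //=; lia.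
have fE k : front o e k = ~~ side_le d p k.
  by move: op; rewrite /front /= /e /end_arrow /side_le; move: k; case: (d) => /= k; case: (o _) => //=; lia.
rewrite /arrow_minus; case: asboolP => [/in_frontE|].
  rewrite fE => npi; split=> [->|[z [_ z0] <-]]; first exact: lin_closed0 (side_space_closed _ _ _ _).
  exact: z0.
move=> /in_frontE/negP; rewrite fE negbK => pi.
have te : (tgt e : int) = if d then p + 1 else p - 1.
  by move: op; rewrite /tgt /= /e /end_arrow /side_le; case: (d) => /=; case: (o _) => //=; lia.
have btwE k : btw (tgt e) k i = (k == tgt e) || side_le d p k && side_le d k i.
  by move: pi; rewrite /btw /side_le te; case: (d); move: (i) k => /= l k; lia.
split=> [/transportP[z [zt <- zc]]|[z [zc z0] <-]].
  exists (fun k => if side_le d p k then z k else 0); last by rewrite pi.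
  split=> [f sb tb pf|_ k /negPf /= ->] //.
  have {zc} := zc f; rewrite !btwE sb [side_le d p (src f)]pf orbT => /(_ isT).
  rewrite /compat [side_le d p (src f)]pf; case: ifP => ptf; first by rewrite tb orbT; apply.
  have fe : f = e.
    have E q r : q = r -> o q = o r by move->.
    move: pf ptf op; rewrite /e /= /side_le /src /tgt /= /end_arrow; move: (f) => /= g.
    move: (E g p) (E g (p - 1)).
    by case: (d) => /=; case: (o g); case: (o p); case: (o (p - 1)); lia.
  by move: zt; rewrite -fe => -> ->; rewrite ?eqxx.
apply/transportP; exists z; split=> //.
  by apply: z0.
move=> f; rewrite !btwE => sf tf.
have [psf sfi] : side_le d p (src f) /\ side_le d (src f) i.
  have /orP[/eqP sfe|/andP[] //] := sf.
  have npt : ~~ side_le d p (tgt f).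
    by apply/negP => /(outward_src op) /=; rewrite sfe (negPf tp).
  by move: tf; rewrite (negPf npt) orbF -sfe eq_sym (negPf (line_st_neq f)).
apply: zc => //; case/orP: tf => [/eqP ->|/andP[] //].
by move: pi; rewrite /side_le te; case: (d); move: (i) => /= l; lia.
Qed.

(** Along the virtual arrow itself every vector extends, so only the part between
    its start and [i] imposes a condition. *)
Lemma varrow_plus_side d j (A : varrow Q) i x :
  (forall k, va_set A k <-> side_le d k j) -> ray d j ->
  varrow_plus (V := V) A x <-> side_space V d None i x.
Proof.
move=> AE rj; have jA : va_set A j by apply/AE; rewrite /side_le; case: (d).
rewrite /varrow_plus; case: asboolP => [/AE ij|nA].
  split=> // _; apply: extension_ray => e sb tb; apply: rj.
    by move: sb ij; rewrite /side_le; case: (d); move: (i) (j) (src e) => /= a b c; lia.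
  by move: tb ij; rewrite /side_le; case: (d); move: (i) (j) (tgt e) => /= a b c; lia.
have ji : ~~ side_le d i j by apply/negP => /AE.
have cE k : va_closest A i k <-> k = j.
  split=> [[/AE kj km]|->].
    move: (km _ jA) kj ji; rewrite /side_le.
    by case: (d); move: (i) (j) (k) => /= a b c; lia.
  split=> // l /AE lj; move: lj ji; rewrite /side_le.
  by case: (d); move: (i) (j) => /= a b; lia.
have btwE k : btw j k i = side_le d j k && side_le d k i.
  by move: ji; rewrite /btw /side_le; case: (d); move: (i) (j) (k) => /= a b c; lia.
split=> [/(_ j) H|[z [zc _] <-] k /cE ->]; last first.
  apply/transportP; exists z; split=> // e; rewrite !btwE => /andP[_ sb] /andP[_ tb].
  exact: zc.
have {H}/transportP[z [_ zx zc]] := H (proj2 (cE j) erefl).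
have [w [wc _] wz] := extension_ray (z j) rj.
have [z' [z'w z'z]] := glue_families d wz; exists z'; last first.
  rewrite z'z // /side_le; move: ji; rewrite /side_le; case: (d); move: (i) (j) => /= a b; lia.
split=> // e sb tb _; case: (boolP (side_le d (src e) j && side_le d (tgt e) j)) => [/andP[sj tj]|nj].
  by apply: (@compat_eq _ _ _ _ w); rewrite ?z'w //; apply: wc.
have [sj tj] : side_le d j (src e) /\ side_le d j (tgt e).
  move: nj; rewrite /side_le /src /tgt /=; move: (e) (j) => /= a b.
  by case: (d); case: (o a); lia.
by apply: (@compat_eq _ _ _ _ z); rewrite ?z'z //; apply: zc; rewrite btwE ?sj ?tj.
Qed.

Hypothesis ho : eventually_outward o.

Lemma eventually_ray d i : exists j, side_le d j i /\ ray d j.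
Proof.
have [N HN] := eventually_bound ho; case: d.
  exists (Num.max (i : int) (N%:Z + 1)); split; first by rewrite /side_le; move: i => /= i; lia.
  move=> e; rewrite /side_le /src /tgt /=; move: e i => /= e i; case: (HN e) => oN _.
  by case: (o e) oN => // oN; lia.
exists (Num.min (i : int) (- N%:Z - 1)); split; first by rewrite /side_le; move: i => /= i; lia.
move=> e; rewrite /side_le /src /tgt /=; move: e i => /= e i; case: (HN e) => _ oN.
by case: (o e) oN => // oN; lia.
Qed.

(** If an end of [a] is infinite, [eventually_ray] provides a virtual arrow inside
    [a] on that side; by [varrow_plus_side] all of them impose the same
    condition. *)
Lemma F_set_side E (a : csubquiver Q) i x : is_ends E a ->
  F_set (V := V) a x <-> forall d, side_space V d (E d) i x.
Proof.
move=> aE; have [m am] := sq_nonempty a; split=> [[Hi Ho Hv] d|H].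
  case Ed: (E d) => [p|].
    case: (boolP (inward o d (Some p))) => dp.
      apply/arrow_plus_side => //; apply: Hi; apply/(ibaP _ aE).
      by exists d, p.
    apply/arrow_minus_side => //; apply: Ho; apply/(obaP _ aE).
    by exists d, p.
  have [j [jm rj]] := eventually_ray d m.
  have [A AE] := ray_varrow rj.
  apply/(varrow_plus_side _ AE rj); apply: Hv => k /AE kj.
  apply/aE/(betweenE d); rewrite Ed; split=> //.
  have := proj1 (aE _) am (~~ d); rewrite /inside; case: (E _) => // q.
  move: jm kj; rewrite /side_le.
  by case: (d) => /=; move: (j) (k) m {am} => /= a1 a2 a3; lia.
split=> [e /(ibaP _ aE)[d [p [Ed -> ip]]]|e /(obaP _ aE)[d [p [Ed -> op]]]|A Aa].
- by apply/arrow_plus_side => //; rewrite -Ed.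
- by apply/arrow_minus_side => //; rewrite -Ed.
have [d [AE rj]] := varrow_shape A.
apply/(varrow_plus_side _ AE rj); rewrite (_ : None = E d) //.
case Ed: (E d) => [p|] //; exfalso.
have {}Aa k : side_le d k (va_vert A 0) -> side_le d p k.
  by move/AE/Aa/aE/(_ d); rewrite Ed.
move: Aa; rewrite /side_le; move: (va_vert A 0) => /= q.
case: (d) => Aa.
  by have := Aa (Num.max q p + 1); lia.
by have := Aa (Num.min q p - 1); lia.
Qed.

(** The homomorphisms from the interval module with ends [E] to [V], given by the
    images of the basis vectors. *)
Definition hom_interval (E : ends) : set M := [set z |
  (forall k, ~ between E k -> z k = 0) /\ (forall e, between E (src e) -> compat z e)].

(** The left and right families agree at [i] and can be glued there; the glued
    family is then cut off outside the interval.  An arrow leaving the interval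
    crosses an outward end, where the family already vanished. *)
Lemma side_space_homP E i x : between E i ->
  (forall d, side_space V d (E d) i x) <-> exists2 z, hom_interval E z & z i = x.
Proof.
move=> Ei; split=> [H|[z [z0 zc] <-] d]; last first.
  exists z => //; split=> [e sb tb se|_ k nk].
    apply: zc; apply/(betweenE d); split=> //.
    have := Ei (~~ d); rewrite /inside; case: (E _) => // p; move: sb; rewrite /side_le.
    by case: (d) => /=; move: (i) (src e) => /= a b; lia.
  by apply: z0 => /(_ d); apply/negP.
have [zl [lc l0] li] := H false; have [zr [rc r0] ri] := H true.
have [z [zL zR]] := @glue_families _ _ _ false i zr zl (etrans li (esym ri)).
exists (fun k => if `[< between E k >] then z k else 0); last first.
  by case: asboolP => // _; rewrite zL // /side_le.
split=> [k nk|e se]; first by case: asboolP.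
have ce : compat z e.
  have [/andP[sb tb]|/andP[sb tb]] : side_le false (src e) i && side_le false (tgt e) i \/
    side_le true (src e) i && side_le true (tgt e) i.
  - by rewrite /side_le /src /tgt /=; move: (e) (i) => /= a b; case: (o a); lia.
  - by apply: (@compat_eq _ _ _ _ zl); rewrite ?zL //; apply: lc => //; apply: se.
  by apply: (@compat_eq _ _ _ _ zr); rewrite ?zR //; apply: rc => //; apply: se.
apply: compat_eq ce; first by rewrite asboolT.
case: asboolP => // nt.
have [d nd] : exists d, ~~ inside d (E d) (tgt e).
  by apply: contra_notP nt => nex d; apply/negP => nd; apply: nex; exists d; apply/negP.
have od : outward o d (E d).
  by apply: contraNT nd => nd; apply: inward_tgt nd (se d).
have td : side_le d (tgt e) i.
  move: (Ei d) nd; rewrite /inside; case: (E d) => // p; rewrite /side_le.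
  by case: (d); move: (i) (tgt e) => /= a b; lia.
by case: d nd od td => nd od td; [rewrite zR // r0 | rewrite zL // l0].
Qed.

End Constraints.

Arguments hom_interval {F o} V E _.

(** * The sum of the lower members of the filtration *)

Section Below.
Variables (F : fieldType) (o : int -> bool) (ho : eventually_outward o).
Variable V : rep F (line o).
Notation Q := (line o).
Notation M := (family (rep_sp V)).
Implicit Types (z w : M) (e : qarr Q) (i j k : qvert Q) (a b c : csubquiver Q).

Lemma F_step_mono a b i : reduction a b \/ enhancement a b ->
  F_set (V := V) b (i := i) `<=` F_set a (i := i).
Proof.
have [E aE] := csub_ends a; move=> /(step_ends aE)[d [x [lt bE]]] u.
move=> /(F_set_side ho _ bE) H; apply/(F_set_side ho _ aE) => d'; have := H d'.
by rewrite /set_end; case: eqP => [->|//]; apply: side_space_mono.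
Qed.

Lemma F_mono a b i : sq_gt a b -> F_set (V := V) b (i := i) `<=` F_set a (i := i).
Proof.
move=> ab; elim: ab i => [{}a {}b ab|{}a c {}b _ ac _ cb] i; first exact: F_step_mono.
by apply: subset_trans (cb i) (ac i).
Qed.

Lemma below_closed a i : lin_closed (F_below V a i).
Proof. exact: lsubP. Qed.

Lemma F_set_closed a i : lin_closed (F_set (V := V) a (i := i)).
Proof. exact: F_closed. Qed.

Lemma F_sub_below a b i : sq_gt a b -> F_set (V := V) b (i := i) `<=` F_below V a i.
Proof.
move=> ab u bu; exists 1%N, (fun=> exist _ b ab), (fun=> u); split=> //.
by rewrite big_ord1.
Qed.

Lemma below_sub a i : F_below V a i `<=` F_set (V := V) a (i := i).
Proof.
move=> _ [n [k [u [Hu ->]]]]; apply: lin_closed_sum => [|m _]; first exact: F_set_closed.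
by apply: (F_mono (svalP (k m))); exact: Hu.
Qed.

(** By monotonicity only single reductions and enhancements of [a] contribute to
    [F_below a]. *)
Lemma sq_gt_first a b : sq_gt a b -> exists2 c, reduction a c \/ enhancement a c &
  forall i, F_set (V := V) b (i := i) `<=` F_set c (i := i).
Proof.
elim=> [{}a {}b ab|{}a c {}b _ [c' ac' cc'] cb _]; first by exists b => // i; exact: subset_refl.
by exists c' => // i; apply: subset_trans (cc' i); apply: F_mono.
Qed.

(** The union of the side spaces of the strictly lower ends; [0] is added because
    there may be none.  It is a subspace because the order on ends is total. *)
Definition lower_side d x i : set (V i) :=
  [set u | u = 0 \/ exists2 y, end_lt o d y x & side_space V d y i u].
Arguments lower_side : clear implicits.

Lemma lower_side_closed d x i : lin_closed (lower_side d x i).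
Proof.
split=> [|l u v]; first by left.
move=> [->|[y yx uy]] [->|[y' yx' vy']].
- by left; rewrite scaler0 addr0.
- by right; exists y' => //; rewrite scaler0 add0r.
- by right; exists y => //; rewrite addr0; apply: lin_closedZ (side_space_closed _ _ _ _) _.
right; case: (end_lt_total o d y y') => [yy'|yy'|yy'].
- by exists y' => //; have [_] := side_space_closed V d y' i; apply=> //; apply: side_space_mono uy.
- by exists y' => //; have [_] := side_space_closed V d y' i; apply=> //; rewrite -yy'.
- by exists y => //; have [_] := side_space_closed V d y i; apply=> //; apply: side_space_mono vy'.
Qed.

Lemma lower_side_sub d x i : lower_side d x i `<=` side_space V d x i.
Proof.
move=> u [->|[y yx uy]]; first exact: lin_closed0 (side_space_closed _ _ _ _).
exact: side_space_mono uy.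
Qed.

Definition below_side (E : ends) d i : set (V i) :=
  lower_side d (E d) i `&` side_space V (~~ d) (E (~~ d)) i.
Arguments below_side : clear implicits.

Lemma below_side_closed E d i : lin_closed (below_side E d i).
Proof.
split=> [|l u v [lu ru] [lv rv]]; first by split; [left|exact: lin_closed0 (side_space_closed _ _ _ _)].
split; first by have [_] := lower_side_closed d (E d) i; apply.
by have [_] := side_space_closed V (~~ d) (E (~~ d)) i; apply.
Qed.

Lemma below_decomp E a i x : is_ends E a -> F_below V a i x ->
  exists u v, [/\ below_side E false i u, below_side E true i v & x = u + v].
Proof.
move=> aE.
pose S := [set x | exists u v, [/\ below_side E false i u, below_side E true i v & x = u + v]].
have SC : lin_closed S.
  split.
    exists 0, 0; rewrite addr0; split=> //; exact: lin_closed0 (below_side_closed _ _ _).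
  move=> l _ _ [u [v [pu pv ->]]] [u' [v' [pu' pv' ->]]].
  exists (l *: u + u'), (l *: v + v'); split.
  - by have [_] := below_side_closed E false i; apply.
  - by have [_] := below_side_closed E true i; apply.
  - by rewrite scalerDr addrACA.
move=> [n [k [u [Hu ->]]]]; apply: (@lin_closed_sum _ _ S) => // m _ {x}.
have [c ac cF] := sq_gt_first (svalP (k m)).
have {cF} cF := cF i _ (Hu m).
have [d [y [lt cE]]] := step_ends aE ac.
have {cF}H := proj1 (F_set_side ho _ cE) cF.
have pd : below_side E d i (u m).
  split; last by have := H (~~ d); rewrite /set_end; case: (d).
  by right; exists y => //; have := H d; rewrite /set_end eqxx.
case: d pd {lt cE H} => pd; [exists 0, (u m)|exists (u m), 0];
  by rewrite ?add0r ?addr0; split=> //; exact: lin_closed0 (below_side_closed _ _ _).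
Qed.

Lemma step_below E a d y i u : is_ends E a -> end_lt o d y (E d) ->
  inside d y i -> inside (~~ d) (E (~~ d)) i ->
  side_space V d y i u -> side_space V (~~ d) (E (~~ d)) i u -> F_below V a i u.
Proof.
move=> aE lt yi Ei yu Eu.
have hc : between (set_end d y E) !=set0 by exists i; apply/between_set.
pose c := interval_csub o hc.
apply: (@F_sub_below _ c).
  by apply: t_step; apply: ends_step lt => //; exact: interval_csub_ends.
apply/(F_set_side ho _ (interval_csub_ends o hc)) => d'; rewrite /set_end; case: eqP => [->//|d'd].
by have -> : d' = ~~ d by case: d' d d'd {lt yi Ei yu Eu hc c} => [] [].
Qed.

Lemma side_space_outside d y i u :
  outward o d y -> ~~ inside d y i -> side_space V d y i u -> u = 0.
Proof. by move=> oy yi [z [_ z0] <-]; apply: z0. Qed.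

(** A lower end that leaves [i] outside has an outward boundary arrow, so its side
    space at [i] is zero. *)
Lemma end_lt_inside d y x i u : end_lt o d y x -> inside d x i -> side_space V d y i u ->
  u = 0 \/ inside d y i.
Proof.
move=> lt xi yu; case: (boolP (inside d y i)) => yi; [by right|left].
have [[_ sub]|[oy _]] := end_lt_cases lt; first by rewrite (sub _ xi) in yi.
exact: side_space_outside yi yu.
Qed.

Lemma below_side_sub E a d i u :
  is_ends E a -> between E i -> below_side E d i u -> F_below V a i u.
Proof.
move=> aE Ei [[->|[y lt yu]] Eu]; first exact: lin_closed0 (below_closed _ _).
have [->|yi] := end_lt_inside lt (Ei d) yu; first exact: lin_closed0 (below_closed _ _).
exact: step_below aE lt yi (Ei _) yu Eu.
Qed.

(** If [F_set a] is nonzero at a vertex outside [a], the boundary arrow on that side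
    points inward.  Then moving the end of [a] past [i] to a place with full side
    space is an enhancement that imposes no new condition at [i]. *)
Lemma F_set_outside_below E a i x : is_ends E a -> ~ between E i ->
  F_set (V := V) a x -> F_below V a i x.
Proof.
move=> aE ni /(F_set_side ho _ aE) H; have [m am] := sq_nonempty a.
have [d nd] : exists d, ~~ inside d (E d) i.
  by apply: contra_notP ni => nex d; apply/negP => nd; apply: nex; exists d; apply/negP.
have [od|nod] := boolP (outward o d (E d)).
  by rewrite (side_space_outside od nd (H d)); exact: lin_closed0 (below_closed _ _).
have [y [yi yfull]] := side_space_full V d i.
apply: (step_below aE) (yi) _ (yfull x) (H _).
  move: nd nod yi; case: (E d) => [p|] //= pi; rewrite negbK => ip.
  case: y {yfull} => [q|] //= qi; rewrite ip andbT; apply/orP; left.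
  by move: pi qi; rewrite /side_le; case: (d); move: (i) => /= l; lia.
have := proj1 (aE _) am; rewrite (betweenE d) => -[md].
move: nd md; rewrite /inside; case: (E d) => // p; case: (E (~~ d)) => // q.
by rewrite /side_le; case: (d) => /=; move: (i) m {am} => /= l m; lia.
Qed.

(** The kernel of [e] inside [F_set a] belongs to the reduction of [a] at [e]: a
    vector killed by [e] extends by zero beyond [src e]. *)
Lemma kernel_below E a e y : is_ends E a -> between E (src e) -> between E (tgt e) ->
  F_set (V := V) a y -> rep_map V e y = 0 -> F_below V a (src e) y.
Proof.
move=> aE sE tE /(F_set_side ho _ aE) H ey.
apply: (step_below (d := o e) (y := Some (src e : int)) aE).
- move: (tE (o e)); case: (E (o e)) => [p|]; rewrite /= /side_le /end_arrow /src /tgt /=.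
    by case oe: (o e); rewrite ?addrK ?oe /=; lia.
  by case oe: (o e); rewrite ?addrK ?oe.
- by rewrite /= /side_le; case: (o e).
- exact: sE.
- exists (dfwith (0 : M) y); last by rewrite dfwith_in.
  split=> [f sb tb sf|_ k nk]; last first.
    by rewrite dfwith_out //; apply: contraNneq nk => <-; rewrite /= /side_le; case: (o e).
  suff -> : f = e.
    by rewrite /compat dfwith_in ey dfwith_out // line_st_neq.
  have E' q r : q = r -> o q = o r by move->.
  move: (E' f e) sb tb sf; rewrite /= /side_le /src /tgt /=; move: (f) (e) => /= g h.
  by case: (o g); case: (o h); lia.
- exact: H.
Qed.

(** A lower interval containing [tgt e] also contains [src e]: otherwise its lowered
    end would be [tgt e], strictly inside [a] with an inward boundary arrow, but the
    boundary arrow created by a reduction points outward.  So a homomorphism with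
    value [u] at [tgt e] has a value at [src e], and that is the lift. *)
Lemma below_side_lift E a d e u : is_ends E a -> between E (src e) -> between E (tgt e) ->
  below_side E d (tgt e) u -> exists2 y, F_below V a (src e) y & rep_map V e y = u.
Proof.
move=> aE sE tE [lu Eu].
have zero : exists2 y, F_below V a (src e) y & rep_map V e y = 0.
  by exists 0; [exact: lin_closed0 (below_closed _ _) | rewrite linear0].
case: lu => [->//|[y lt yu]].
have [->//|yt] := end_lt_inside lt (tE d) yu.
have ys : inside d y (src e).
  have [[_ sub]|[oy _]] := end_lt_cases lt; first exact: sub.
  exact: outward_src yt.
have cs : between (set_end d y E) (src e) by apply/between_set.
have ct : between (set_end d y E) (tgt e) by apply/between_set.
have [z zH zt] : exists2 z, hom_interval V (set_end d y E) z & z (tgt e) = u.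
  apply/(side_space_homP _ ct) => d'; rewrite /set_end; case: eqP => [->//|d'd].
  by have -> : d' = ~~ d by case: d' d d'd {lt ys yt yu Eu cs ct} => [] [].
exists (z (src e)); last by rewrite -zt; case: zH => _; apply.
have H : forall d', side_space V d' (set_end d y E d') (src e) (z (src e)).
  by apply/(side_space_homP _ cs); exists z.
apply: (step_below aE lt ys (sE _)); first by have := H d; rewrite /set_end eqxx.
by have := H (~~ d); rewrite /set_end; case: (d).
Qed.

Lemma hom_interval_F_set E a z i :
  is_ends E a -> hom_interval V E z -> between E i -> F_set (V := V) a (z i).
Proof. by move=> aE zH iE; apply/(F_set_side ho _ aE)/(side_space_homP _ iE); exists z. Qed.

(** Lift the two components of the value at [tgt e]; what remains of the value at
    [src e] is killed by [e]. *)
Lemma below_pull E a z e : is_ends E a -> hom_interval V E z ->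
  between E (src e) -> between E (tgt e) ->
  F_below V a (tgt e) (z (tgt e)) -> F_below V a (src e) (z (src e)).
Proof.
move=> aE zH sE tE /(below_decomp aE)[u [v [pu pv zuv]]].
have [y yb yu] := below_side_lift aE sE tE pu; have [y' yb' yv] := below_side_lift aE sE tE pv.
rewrite -(subrK (y + y') (z (src e))); apply: lin_closedD; first exact: below_closed.
  apply: (kernel_below aE) => //.
    apply: lin_closedB; [exact: F_set_closed|exact: hom_interval_F_set zH sE|].
    by apply: lin_closedD; [exact: F_set_closed|exact: below_sub|exact: below_sub].
  by rewrite linearB linearD yu yv -zuv; case: zH => _ /(_ e sE) ->; rewrite subrr.
by apply: lin_closedD => //; exact: below_closed.
Qed.

(** One direction along an arrow is the stability of a subrepresentation, the
    other is [below_pull]. *)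
Lemma below_transfer E a z i j : is_ends E a -> hom_interval V E z ->
  between E i -> between E j -> F_below V a i (z i) -> F_below V a j (z j).
Proof.
move=> aE zH iE jE; have [w wE] := between_connected o iE jE.
elim: w wE {jE} => [|e w IH|e w IH] //= wE zi.
- have wE' k : k \in walk_verts w -> between E k.
    by move=> kw; apply: wE; rewrite inE kw orbT.
  case: zH => z0 zc; rewrite -zc; last by apply: wE'; apply: walk_end.
  by apply: (@sr_stable _ _ _ (F_below V a)); apply: IH.
have wE' k : k \in walk_verts w -> between E k.
  by move=> kw; apply: wE; rewrite inE kw orbT.
apply: (below_pull aE zH).
- by apply: wE; rewrite inE eqxx.
- by apply: wE'; apply: walk_end.
- exact: IH.
Qed.

Lemma hom_interval_closed E : lin_closed (hom_interval V E).
Proof.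
split=> [|l z w [z0 zc] [w0 wc]].
  by split=> // e _; exact: (linear0 (rep_map V e)).
split=> [k nk|e es]; first by rewrite family_linE z0 // w0 // scaler0 addr0.
by apply: compat_lin; [apply: zc | apply: wc].
Qed.

(** [C] is a space of homomorphisms from the interval module whose evaluation at any
    vertex of the interval is a complement of [F_below] in [F_set]. *)
Record core E a (C : set M) : Prop := Core {
  core_closed : lin_closed C;
  core_hom : C `<=` hom_interval V E;
  core_below : forall z i, C z -> between E i -> F_below V a i (z i) -> z = 0;
  core_full : forall i x, between E i -> F_set (V := V) a x ->
    exists2 z, C z & F_below V a i (x - z i) }.

(** A complement of the homomorphisms with value in [F_below] at one vertex works
    for all vertices, by [below_transfer]. *)
Lemma core_exists E a : is_ends E a -> exists C, core E a C.
Proof.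
move=> aE; have [i0 /aE i0E] := sq_nonempty a.
pose R : set M := [set z | hom_interval V E z /\ F_below V a i0 (z i0)].
have RC : lin_closed R.
  split.
    by split; [exact: lin_closed0 (hom_interval_closed _)|exact: lin_closed0 (below_closed _ _)].
  move=> l z w [zH zb] [wH wb]; split; first by have [_] := hom_interval_closed E; apply.
  by rewrite family_linE; have [_] := below_closed a i0; apply.
have [C [CC CH CR Cfull]] := exists_complement RC (hom_interval_closed E) (fun z Rz => Rz.1).
exists C; split=> // [z i Cz iE zb|i x iE].
  by apply: CR => //; split; [exact: CH|exact: below_transfer (CH _ Cz) iE i0E zb].
move=> /(F_set_side ho _ aE)/(side_space_homP _ iE)[z zH <-].
have [c Cc [dH db]] := Cfull z zH; exists c => //.
rewrite -family_subE; exact: below_transfer dH i0E iE db.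
Qed.

End Below.
Arguments lower_side {F o} V d x i _.
Arguments below_side {F o} V E d i _.

Lemma inj_surj_bij (A B : Type) (f : A -> B) :
  injective f -> (forall y, exists x, f x = y) -> bijective f.
Proof.
move=> fi fs; have [g gK] := choice fs; exists g => // x.
by apply: fi; rewrite gK.
Qed.

Lemma fsbig_zmod_seq (T : choiceType) (M : zmodType) (r : seq T) (u : T -> M) :
  uniq r -> (forall k, k \notin r -> u k = 0) ->
  \sum_(k \in [set: T]) u k = \sum_(k <- r) u k.
Proof.
move=> ur u0; rewrite (fsbigE r) // => [|k _]; last exact: u0.
by apply: eq_bigl => k; exact: in_setT.
Qed.

(** * Complements and quotients *)

Section ComplementIso.
Variables (F : fieldType) (Q : quiver) (V : rep F Q) (A B U : subrep V).
Hypothesis UA : forall i (x : V i), U i x -> A i x.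

Definition to_quot i (x : sub_rep U i) : quot_rep (Defs.restrict A B) i :=
  lquot_pi (Defs.restrict A B i)
    (exist _ (val x) (asboolT (UA (asboolW (valP x)))) : Defs.lsub (A i)).

Fact to_quot_linear i : linear (@to_quot i).
Proof.
by move=> l x y; rewrite /to_quot -linearP; congr (lquot_pi _ _); apply: val_inj.
Qed.

HB.instance Definition _ i :=
  GRing.isLinear.Build F _ _ _ (@to_quot i) (@to_quot_linear i).

Hypothesis UB : forall i (x : V i), U i x -> B i x -> x = 0.
Hypothesis AUB : forall i (x : V i), A i x -> exists2 u, U i u & B i (x - u).

Lemma to_quot_bij i : bijective (@to_quot i).
Proof.
apply: inj_surj_bij => [x y /lquot_eqP xy|q].
  apply: val_inj; apply/eqP; rewrite -subr_eq0; apply/eqP; apply: UB xy.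
  by apply: lin_closedB; [exact: lsubP|exact: asboolW (valP x)|exact: asboolW (valP y)].
have [u Uu Bxu] := AUB (asboolW (valP (repr q))).
exists (exist _ u (asboolT Uu)); rewrite -[q]lquot_piK; apply/lquot_eqP.
rewrite -opprB; have [B0 BL] := lsubP (B i).
by rewrite /= /restrict_set /= -scaleN1r -[_ *: _]addr0; apply: BL.
Qed.

Lemma to_quot_nat e (x : sub_rep U (src e)) :
  to_quot (rep_map (sub_rep U) e x) = rep_map (quot_rep (Defs.restrict A B)) e (to_quot x).
Proof.
rewrite [RHS]quot_map_pi; congr (lquot_pi _ _); exact: val_inj.
Qed.

Lemma complement_iso : rep_iso (sub_rep U) (quot_rep (Defs.restrict A B)).
Proof.
constructor; exists (fun i => @to_quot i : {linear _ -> _}).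
  exact: to_quot_bij.
exact: to_quot_nat.
Qed.

End ComplementIso.

(** * Interval modules are indecomposable *)

Section IntervalModule.
Variables (F : fieldType) (o : int -> bool) (a : csubquiver (line o)).
Notation Q := (line o).

Fact supp_closed i : lin_closed [set x : F^o | sq_verts a i \/ x = 0].
Proof.
split; first by right.
by move=> l x y [ai _|-> [ai|->]]; [left|left|right; rewrite scaler0 addr0].
Qed.

(** A subspace of the ground field, all of it or zero: this gives the interval module
    without a case distinction in its types. *)
Definition supp i : lsubspace F^o := LSubspace (supp_closed i).

Fact interval_map_subproof e (x : Defs.lsub (supp (src e))) :
  supp (tgt e) (if `[< sq_verts a (tgt e) >] then val x else 0).
Proof. by case: asboolP => ta; [left|right]. Qed.

Definition interval_map e (x : Defs.lsub (supp (src e))) : Defs.lsub (supp (tgt e)) :=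
  exist _ (if `[< sq_verts a (tgt e) >] then val x else 0)
    (asboolT (interval_map_subproof x)).

Fact interval_map_linear e : linear (@interval_map e).
Proof.
move=> l x y; apply: val_inj => /=; case: asboolP => // _.
by rewrite scaler0 addr0.
Qed.

HB.instance Definition _ e :=
  GRing.isLinear.Build F _ _ _ (@interval_map e) (@interval_map_linear e).

Definition interval_rep : rep F Q :=
  @Rep F Q (fun i => Defs.lsub (supp i)) (fun e => @interval_map e).

Fact supp_one_subproof i : supp i (if `[< sq_verts a i >] then 1 else 0).
Proof. by case: asboolP => ai; [left|right]. Qed.

Definition supp_one i : interval_rep i :=
  exist _ (if `[< sq_verts a i >] then 1 else 0 : F^o) (asboolT (supp_one_subproof i)).

Lemma supp_oneE i : sq_verts a i -> val (supp_one i) = 1.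
Proof. by move=> ai; rewrite /= asboolT. Qed.

Lemma supp_scale i (x : interval_rep i) : sq_verts a i -> x = (val x : F) *: supp_one i.
Proof. by move=> ai; apply: val_inj => /=; rewrite asboolT //; exact/esym/mulr1. Qed.

Lemma supp0 i (x : interval_rep i) : ~ sq_verts a i -> x = 0.
Proof. by move=> ai; apply: val_inj; case: (asboolW (valP x)). Qed.

Lemma interval_map_one e : sq_verts a (src e) -> sq_verts a (tgt e) ->
  rep_map interval_rep e (supp_one (src e)) = supp_one (tgt e).
Proof. by move=> sa ta; apply: val_inj => /=; rewrite !asboolT. Qed.

(** At each vertex exactly one of the two summands contains the basis vector; arrows
    carry basis vectors to basis vectors, so by connectedness it is always the same
    summand, and that summand is everything. *)
Lemma interval_indecomposable : indecomposable interval_rep.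
Proof.
have [i0 ai0] := sq_nonempty a; split.
  exists i0, (supp_one i0); apply/eqP => /(congr1 val); rewrite supp_oneE // => /eqP.
  by rewrite oner_eq0.
move=> [U [Udir Uprop]].
have not_both i b : sq_verts a i -> U b i (supp_one i) -> U (~~ b) i (supp_one i) -> False.
  move=> ai U1 U2; have [u [_ uu]] := Udir i (supp_one i).
  pose w (c : bool) : bool -> interval_rep i := fun c' => if c' == c then supp_one i else 0.
  have wP c : U c i (supp_one i) -> u = w c.
    move=> Uc; apply: uu; split.
    - move=> k; rewrite /w; case: eqP => [->//|_].
      exact: lin_closed0 (lsubP (U k i)).
    - exact: finite_finset.
    - rewrite (@fsbig_zmod_seq _ _ [:: c; ~~ c]) /w.
      + by rewrite !big_cons big_nil eqxx addrC; case: (c); rewrite /= !add0r.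
      + by case: (c).
      + by case: (c) => -[].
  have := congr1 (fun f => val (f b)) (etrans (esym (wP _ U1)) (wP _ U2)).
  rewrite /w eqxx supp_oneE //; case: (b) => /= /eqP; by rewrite oner_eq0.
have some i : sq_verts a i -> exists b, U b i (supp_one i).
  move=> ai; have [u [[uU _ one] _]] := Udir i (supp_one i).
  have [b ub] : exists b, u b != 0.
    apply: contrapT => nb; have u0 b : u b = 0.
      by apply/eqP; apply: contrapT => /negP ub; apply: nb; exists b.
    have := congr1 val one; rewrite fsbig1 // supp_oneE // => /eqP.
    by rewrite oner_eq0.
  exists b; have vb : (val (u b) : F) != 0.
    by apply: contraNneq ub => vb; apply/eqP; apply: val_inj.
  rewrite -[supp_one i]scale1r -(mulVf vb) -scalerA -supp_scale //.
  by apply: lin_closedZ; [exact: lsubP|exact: uU].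
have [b Ub] := some _ ai0.
have all_b i : sq_verts a i -> U b i (supp_one i).
  move=> ai; have [w wa] := sq_connected ai0 ai.
  elim: w wa {ai} => [|e w IH|e w IH] //= wa.
  - have wa' k : k \in walk_verts w -> sq_verts a k.
      by move=> kw; apply: wa; rewrite inE kw orbT.
    rewrite -interval_map_one; [|by apply: wa'; apply: walk_end|by apply: wa; rewrite inE eqxx].
    by apply: (@sr_stable _ _ _ (U b)); apply: IH.
  have wa' k : k \in walk_verts w -> sq_verts a k.
    by move=> kw; apply: wa; rewrite inE kw orbT.
  have sa : sq_verts a (src e) by apply: wa; rewrite inE eqxx.
  have ta : sq_verts a (tgt e) by apply: wa'; apply: walk_end.
  have [b' Ub'] := some _ sa.
  have Ubt := IH wa'.
  have : U b' (tgt e) (supp_one (tgt e)).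
    by rewrite -interval_map_one //; apply: (@sr_stable _ _ _ (U b')).
  case: (eqVneq b' b) Ub' => [->//|b'b] _ Ub't.
  have bb' : b' = ~~ b by case: (b) (b') b'b => [] [].
  by rewrite bb' in Ub't; case: (not_both _ _ ta Ubt Ub't).
have [[i [x nx]] _] := Uprop b.
apply: nx; have [ai|nai] := pselect (sq_verts a i).
  by rewrite (supp_scale x ai); apply: lin_closedZ; [exact: lsubP|exact: all_b].
by rewrite (supp0 x nai); exact: lin_closed0 (lsubP (U b i)).
Qed.

End IntervalModule.

(** * The quotients are isotypic *)

Section CoreRep.
Variables (F : fieldType) (o : int -> bool) (ho : eventually_outward o).
Variable V : rep F (line o).
Notation Q := (line o).
Notation M := (family (rep_sp V)).
Variables (E : ends) (a : csubquiver Q) (aE : is_ends E a) (C : set M).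
Hypothesis HC : core E a C.
Implicit Types (e : qarr Q) (i j k : qvert Q).

Definition core_set i : set (V i) := [set x | exists2 z, C z & z i = x].

Fact core_set_closed i : lin_closed (@core_set i).
Proof.
have [C0 CL] := core_closed HC; split; first by exists 0.
by move=> l _ _ [z Cz <-] [w Cw <-]; exists (l *: z + w) => //; apply: CL.
Qed.

Fact core_set_stable e (x : V (src e)) :
  LSubspace (@core_set_closed (src e)) x ->
  LSubspace (@core_set_closed (tgt e)) (rep_map V e x).
Proof.
move=> [z Cz <-]; have [z0 zc] := core_hom HC Cz.
have [sE|nE] := pselect (between E (src e)); first by exists z => //; rewrite zc.
by rewrite z0 // linear0; exact: lin_closed0 (core_set_closed _).
Qed.

Definition core_rep : subrep V :=
  @SubRep F Q V (fun i => LSubspace (@core_set_closed i)) core_set_stable.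

Lemma core_rep0 i x : ~ between E i -> core_rep i x -> x = 0.
Proof. by move=> ni [z Cz <-]; have [z0 _] := core_hom HC Cz; exact: z0. Qed.

Lemma core_rep_F i x : core_rep i x -> F_rep V a i x.
Proof.
move=> xC; have [iE|ni] := pselect (between E i).
  by case: xC => z Cz <-; exact: hom_interval_F_set (core_hom HC Cz) iE.
by rewrite (core_rep0 ni xC); exact: lin_closed0 (lsubP (F_rep V a i)).
Qed.

Lemma core_rep_below i x : core_rep i x -> F_below V a i x -> x = 0.
Proof.
move=> xC; have [iE|ni] := pselect (between E i); last by rewrite (core_rep0 ni xC).
by case: xC => z Cz <- zb; rewrite (core_below HC Cz iE zb).
Qed.

Lemma core_rep_full i x : F_rep V a i x -> exists2 u, core_rep i u & F_below V a i (x - u).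
Proof.
move=> xF; have [iE|ni] := pselect (between E i).
  have [z Cz zb] := core_full HC iE xF.
  by exists (z i) => //; exists z.
exists 0; first exact: lin_closed0 (core_set_closed i).
by rewrite subr0; exact: F_set_outside_below ni xF.
Qed.

Lemma core_iso : rep_iso (sub_rep core_rep) (W_rep V a).
Proof.
exact: (complement_iso core_rep_F core_rep_below core_rep_full).
Qed.

Notation Y := (Defs.lsub (LSubspace (core_closed HC))).
Notation phi i := (@to_quot F Q V (F_rep V a) (F_below V a) core_rep core_rep_F i).

Fact core_ev_subproof i (y : Y) : core_rep i (val y i).
Proof. by exists (val y) => //; exact: asboolW (valP y). Qed.

Definition core_ev i (y : Y) : sub_rep core_rep i :=
  exist _ (val y i) (asboolT (core_ev_subproof i y)).

Fact core_ev_linear i : linear (@core_ev i).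
Proof. by move=> l x y; apply: val_inj. Qed.

HB.instance Definition _ i := GRing.isLinear.Build F _ _ _ (@core_ev i) (@core_ev_linear i).

Lemma core_ev_bij i : between E i -> bijective (@core_ev i).
Proof.
move=> iE; apply: inj_surj_bij => [x y xy|u].
  have {}xy : val x i = val y i := congr1 val xy.
  apply: val_inj; apply/eqP; rewrite -subr_eq0; apply/eqP.
  apply: (core_below HC) iE _.
    by apply: lin_closedB; [exact: core_closed HC|exact: asboolW (valP x)|exact: asboolW (valP y)].
  by rewrite family_subE xy subrr; exact: lin_closed0 (lsubP (F_below V a i)).
have [z Cz zu] := asboolW (valP u).
by exists (exist _ z (asboolT Cz)); apply: val_inj.
Qed.

(** At a vertex of the interval this identifies [C] with the fibre of [W_rep], and
    independently of the vertex: it is the second factor of the tensor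
    decomposition. *)
Definition core_quot i (y : Y) : W_rep V a i := phi i (core_ev i y).

Fact core_quot_linear i : linear (@core_quot i).
Proof. by move=> l x y; rewrite /core_quot !linearP. Qed.

HB.instance Definition _ i := GRing.isLinear.Build F _ _ _ (@core_quot i) (@core_quot_linear i).

Lemma core_quot_bij i : between E i -> bijective (@core_quot i).
Proof.
move=> iE; apply: (bij_comp (f := phi i)); last exact: core_ev_bij.
exact: to_quot_bij core_rep_below core_rep_full _.
Qed.

Lemma W_rep_outside i (q : W_rep V a i) : ~ between E i -> q = 0.
Proof.
move=> ni; have [g gK Kg] := to_quot_bij core_rep_F core_rep_below core_rep_full i.
rewrite -[q]Kg (_ : g q = 0) ?linear0 //; apply: val_inj.
exact: core_rep0 ni (asboolW (valP (g q))).
Qed.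

Lemma core_quot_nat e (y : Y) : between E (src e) ->
  rep_map (W_rep V a) e (core_quot (src e) y) = core_quot (tgt e) y.
Proof.
move=> sE; rewrite /core_quot -to_quot_nat; congr (phi _ _); apply: val_inj => /=.
by have [_ zc] := core_hom HC (asboolW (valP y)); rewrite -zc.
Qed.

Notation X := (interval_rep F a).

Definition interval_pairing i (x : X i) (y : Y) : W_rep V a i := (val x : F) *: core_quot i y.

Lemma interval_pairing_bilinear i : bilinear_map (@interval_pairing i).
Proof.
split=> [x l y y'|y l x x']; rewrite /interval_pairing.
  by rewrite linearP scalerDr !scalerA mulrC.
by rewrite scalerDl scalerA.
Qed.

(** Inside the interval the first factor is the ground field and [core_quot] is
    bijective; outside, both the first factor and [W_rep] are zero. *)
Lemma interval_pairing_tensor i : is_tensor_product (@interval_pairing i).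
Proof.
split=> [|Z g [glin grlin]]; first exact: interval_pairing_bilinear.
have [iE|ni] := pselect (between E i); last first.
  have X0 (x : X i) : x = 0 by apply: supp0 => /aE.
  exists (fun=> 0); split.
    split=> [l x y|x y]; first by rewrite scaler0 addr0.
    by rewrite (X0 x) (linear_fun0 (grlin y)).
  move=> h [hlin _]; apply/funext => q.
  by rewrite (W_rep_outside q ni) (linear_fun0 hlin).
have [psi' psiK Kpsi] := core_quot_bij iE.
have ai : sq_verts a i by apply/aE.
exists (g (supp_one F a i) \o psi'); split.
  split=> [l q r|x y] /=.
    rewrite -(glin _ l); congr (g _ _).
    by apply: (can_inj psiK); rewrite Kpsi core_quot_linear !Kpsi.
  rewrite /interval_pairing -linearZ psiK (linear_funZ _ _ (glin _)) -(linear_funZ _ _ (grlin _)).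
  by rewrite -supp_scale.
move=> h [hlin hp]; apply/funext => q /=.
by rewrite -hp /interval_pairing Kpsi supp_oneE // scale1r.
Qed.

Lemma W_rep_isotypic : isotypic (W_rep V a).
Proof.
exists X, Y, interval_pairing; split.
- exact: interval_indecomposable.
- exact: interval_pairing_tensor.
move=> e x y; have [sE|ns] := pselect (between E (src e)); last first.
  have -> : x = 0 by apply: supp0 => /aE.
  have p0 i : interval_pairing (0 : X i) y = 0 by exact: linear_fun0 ((interval_pairing_bilinear i).2 y).
  by rewrite p0 (linear0 (rep_map X e)) p0 linear0.
rewrite /interval_pairing linearZ /= core_quot_nat //; case: asboolP => //.
by move=> nt; rewrite (W_rep_outside (core_quot _ y)) ?scaler0 // => /aE.
Qed.

End CoreRep.

(** * The direct sum decomposition *)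

Lemma exists_maximal (T : eqType) (lt : rel T) (s : seq T) :
  transitive lt -> irreflexive lt -> s != [::] ->
  exists2 m, m \in s & forall x, x \in s -> ~~ lt m x.
Proof.
move=> tr ir; elim: s => // x s IH _; have [->|/IH[m ms mmax]] := eqVneq s [::].
  by exists x; rewrite ?inE // => y; rewrite inE => /eqP ->; rewrite ir.
have [mx|nmx] := boolP (lt m x).
  exists x; first by rewrite inE eqxx.
  move=> y; rewrite inE => /predU1P[->|ys]; first by rewrite ir.
  by apply: contra (mmax y ys); apply: tr.
exists m; first by rewrite inE ms orbT.
by move=> y; rewrite inE => /predU1P[->|/mmax].
Qed.

Section SpanFamily.
Variables (F : fieldType) (Q : quiver) (V : rep F Q) (I : choiceType).
Variables (U : I -> subrep V) (i : qvert Q).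

Definition admissible (u : I -> V i) : Prop :=
  (forall k, U k i (u k)) /\ finite_set [set k | u k != 0].

Lemma admissible_seq u : admissible u -> exists r, [/\ uniq r,
  forall k, (k \in r) = (u k != 0) & \sum_(k \in [set: I]) u k = \sum_(k <- r) u k].
Proof.
move=> [_ /finite_seqP[s sE]]; exists (undup s).
have mE k : (k \in undup s) = (u k != 0).
  rewrite mem_undup; have := congr1 (fun S : set I => S k) sE.
  by move=> /= E; apply/idP/idP; rewrite -[is_true (k \in s)]E.
split=> //; first exact: undup_uniq.
apply: fsbig_zmod_seq; first exact: undup_uniq.
by move=> k; rewrite mE negbK => /eqP.
Qed.

Lemma admissible_lin l u v : admissible u -> admissible v ->
  admissible (fun k => l *: u k + v k) /\
  \sum_(k \in [set: I]) (l *: u k + v k) =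
    l *: \sum_(k \in [set: I]) u k + \sum_(k \in [set: I]) v k.
Proof.
move=> au av; have [ru [uru mu su]] := admissible_seq au.
have [rv [urv mv sv]] := admissible_seq av.
pose r := undup (ru ++ rv); have ur : uniq r := undup_uniq _.
have off k : k \notin r -> u k = 0 /\ v k = 0.
  by rewrite mem_undup mem_cat negb_or mu mv !negbK => /andP[/eqP -> /eqP ->].
split; last first.
  rewrite !(@fsbig_zmod_seq _ _ r) //; first by rewrite big_split scaler_sumr.
  - by move=> k /off[].
  - by move=> k /off[].
  - by move=> k /off[-> ->]; rewrite scaler0 addr0.
split.
  move=> k; have [_] := lsubP (U k i); apply; [exact: au.1|exact: av.1].
apply: (@sub_finite_set _ _ [set` r]); last exact: finite_seq.
move=> k /= uk; apply: contraT => /off[u0 v0].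
by move: uk; rewrite u0 v0 scaler0 addr0 eqxx.
Qed.

Definition span_set : set (V i) :=
  [set x | exists2 u, admissible u & x = \sum_(k \in [set: I]) u k].

Lemma span_closed : lin_closed span_set.
Proof.
split=> [|l _ _ [u au ->] [v av ->]].
  exists (fun=> 0); last by rewrite fsbig1.
  split=> [k|]; first exact: lin_closed0 (lsubP _).
  by rewrite (_ : [set _ | _] = set0) //; apply/seteqP; split=> k //=; rewrite eqxx.
have [aw <-] := admissible_lin l au av.
by exists (fun k => l *: u k + v k).
Qed.

Lemma span_sub k x : U k i x -> span_set x.
Proof.
move=> kx; pose u k' := if k' == k then x else 0.
have off k' : k' \notin [:: k] -> u k' = 0 by rewrite inE /u => /negPf ->.
exists u; last by rewrite (@fsbig_zmod_seq _ _ [:: k]) // big_seq1 /u eqxx.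
split=> [k'|].
  by rewrite /u; case: eqP => [->//|_]; exact: lin_closed0 (lsubP _).
apply: (@sub_finite_set _ _ [set` [:: k]]); last exact: finite_seq.
by move=> k' /= uk; apply: contraT => /off u0; rewrite u0 eqxx in uk.
Qed.

End SpanFamily.

Arguments span_set {F Q V I} U i _.

Lemma direct_sumP (F : fieldType) (Q : quiver) (V : rep F Q) (I : choiceType)
    (U : I -> subrep V) :
  (forall i x, span_set U i x) ->
  (forall i (u : I -> V i), admissible U u -> \sum_(k \in [set: I]) u k = 0 ->
    forall k, u k = 0) ->
  is_direct_sum U.
Proof.
move=> Uspan Uindep i x; have [u au xu] := Uspan i x.
exists u; split; first by split=> //; case: au.
move=> v [vU vfin xv]; apply/funext => k.
have av : admissible U v by split.
have [aw ws] := admissible_lin (-1) av au.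
have := Uindep i _ aw; rewrite ws -xu -xv scaleN1r addNr => /(_ erefl k).
by rewrite scaleN1r addrC => /eqP; rewrite subr_eq0 => /eqP.
Qed.

Section Decomposition.
Variables (F : fieldType) (o : int -> bool) (ho : eventually_outward o).
Variable V : rep F (line o).
Notation Q := (line o).
Notation M := (family (rep_sp V)).
Implicit Types (i : qvert Q).

Definition pair_ends (p : option int * option int) : ends :=
  fun d => if d then p.2 else p.1.

(** The index type keeps the pairs of ends rather than the subquivers, because it
    has to be a choice type. *)
Definition interval := {p : option int * option int | `[< between (pair_ends p) !=set0 >]}.

Definition interval_sq (p : interval) : csubquiver Q := interval_csub o (asboolW (valP p)).

Lemma interval_core (p : interval) :
  exists C : set M, core (pair_ends (val p)) (interval_sq p) C.
Proof. by apply: core_exists => //; exact: interval_csub_ends. Qed.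

Definition summand (p : interval) : subrep V := core_rep (svalP (cid (interval_core p))).

Lemma summand_F p i x : summand p i x -> F_rep V (interval_sq p) i x.
Proof. exact: core_rep_F. Qed.

Lemma summand_side p i x d : summand p i x -> side_space V d (pair_ends (val p) d) i x.
Proof. by move=> /summand_F /(F_set_side ho _ (interval_csub_ends o _)). Qed.

(** Well-founded induction, first on the left end and then on the right end: after the
    core component is removed, each of the two components of the rest belongs to
    an interval with one end lowered. *)
Lemma span_interval (x y : option int) i v : between (pair_ends (x, y)) i ->
  side_space V false x i v -> side_space V true y i v -> span_set summand i v.
Proof.
elim/(well_founded_ind (end_lt_wf ho false)): x => x IHx in y v *.
elim/(well_founded_ind (end_lt_wf ho true)): y => y IHy in v *.
move=> iE xv yv; pose E := pair_ends (x, y).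
have hE : between E !=set0 by exists i.
pose p : interval := exist _ (x, y) (asboolT hE).
have pE : is_ends E (interval_sq p) by exact: interval_csub_ends.
have vF : F_set (V := V) (interval_sq p) v by apply/(F_set_side ho _ pE) => -[].
have [c Uc bc] := core_rep_full ho pE (svalP (cid (interval_core p))) vF.
rewrite -[v](subrK c) addrC; apply: lin_closedD; first exact: span_closed.
  exact: (@span_sub _ _ _ _ _ _ p).
have [u [w [[ul ur] [wl wr] ->]]] := below_decomp ho pE bc.
apply: lin_closedD; first exact: span_closed.
  case: ul => [->|[x' lt x'u]]; first exact: lin_closed0 (span_closed _ _).
  have [->|ix'] := end_lt_inside lt (iE false) x'u; first exact: lin_closed0 (span_closed _ _).
  apply: IHx lt _ _ _ x'u ur.
  by apply/(betweenE false); split=> //; exact: (iE true).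
case: wl => [->|[y' lt y'w]]; first exact: lin_closed0 (span_closed _ _).
have [->|iy'] := end_lt_inside lt (iE true) y'w; first exact: lin_closed0 (span_closed _ _).
apply: IHy lt _ _ wr y'w.
by apply/(betweenE true); split=> //; exact: (iE false).
Qed.

Lemma summand_span i v : span_set summand i v.
Proof.
have [x [ix xfull]] := side_space_full V false i; have [y [iy yfull]] := side_space_full V true i.
by apply: span_interval (xfull v) (yfull v); apply/(betweenE false).
Qed.

Definition lt_lex (p q : interval) : bool :=
  end_lt o false (val p).1 (val q).1 ||
  ((val p).1 == (val q).1) && end_lt o true (val p).2 (val q).2.

Lemma lt_lex_trans : transitive lt_lex.
Proof.
move=> q p r; rewrite /lt_lex.
case/orP => [pq|/andP[/eqP -> pq]]; case/orP => [qr|/andP[/eqP <- qr]].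
- by rewrite (end_lt_trans pq qr).
- by rewrite pq.
- by rewrite qr.
- by rewrite eqxx (end_lt_trans pq qr) orbT.
Qed.

Lemma lt_lex_irr : irreflexive lt_lex.
Proof. by move=> p; rewrite /lt_lex !end_lt_irr andbF. Qed.

Lemma lt_lex_total p q : ~~ lt_lex p q -> p != q -> lt_lex q p.
Proof.
rewrite /lt_lex => npq pq.
case: (end_lt_total o false (val p).1 (val q).1) npq => [->//|e1|->//] npq.
rewrite e1 eqxx /= in npq *; case: (end_lt_total o true (val p).2 (val q).2) npq => [->|e2|->] //.
  by rewrite orbT.
move=> _; case/eqP: pq; apply: val_inj.
by move: e1 e2; case: (val p) (val q) => [? ?] [? ?] /= -> ->.
by rewrite orbT.
Qed.

(** Take the term with lexicographically largest ends.  The terms with a lower left end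
    add up to some [s], the ones with the same left end and a lower right end to
    some [t]; [s] is the sum of two vectors of the right space of the largest
    term, so both [s] and [t] are in [F_below]. *)
Lemma summand_indep i (u : interval -> V i) : admissible summand u ->
  \sum_(k \in [set: interval]) u k = 0 -> forall k, u k = 0.
Proof.
move=> au; have [r [ur mr ->]] := admissible_seq au => sum0.
suff r0 : r = [::] by move=> k; apply/eqP; rewrite -[_ == _]negbK -mr r0.
apply/eqP; apply: contraT => /(exists_maximal lt_lex_trans lt_lex_irr)[m mrr mmax].
have um0 : u m != 0 by rewrite -mr.
pose E := pair_ends (val m); have mE : is_ends E (interval_sq m) by exact: interval_csub_ends.
pose S : set (V i) := [set x | exists s t, [/\ lower_side V false (E false) i s,
  below_side V E true i t & x = s + t]].
have SC : lin_closed S.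
  split.
    exists 0, 0; rewrite addr0; split=> //.
      exact: lin_closed0 (lower_side_closed _ _ _ _).
    exact: lin_closed0 (below_side_closed _ _ _ _).
  move=> l _ _ [s [t [ls pt ->]]] [s' [t' [ls' pt' ->]]].
  exists (l *: s + s'), (l *: t + t'); split.
  - by have [_] := lower_side_closed V false (E false) i; apply.
  - by have [_] := below_side_closed V E true i; apply.
  - by rewrite scalerDr addrACA.
have other k : k \in r -> k != m -> S (u k).
  move=> kr km; have uk := au.1 k.
  have := lt_lex_total (mmax k kr); rewrite eq_sym => /(_ km); case/orP => [lt|/andP[/eqP e1 lt]].
    exists (u k), 0; rewrite addr0; split=> //.
      by right; exists (val k).1 => //; exact: (summand_side false uk).
    exact: lin_closed0 (below_side_closed _ _ _ _).
  exists 0, (u k); rewrite add0r; split=> //.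
    exact: lin_closed0 (lower_side_closed _ _ _ _).
  split; first by right; exists (val k).2 => //; exact: (summand_side true uk).
  by have := summand_side false uk; rewrite /= e1.
have {other} : S (- u m).
  have := sum0; rewrite (bigD1_seq m) //= => /eqP; rewrite addr_eq0 => /eqP ->.
  rewrite opprK big_seq_cond; apply: (lin_closed_sum _ SC) => k /andP[kr km].
  exact: other.
move=> [s [t [ls pt umst]]].
have [iE|ni] := pselect (between E i); last first.
  by move: um0; rewrite (core_rep0 ni (au.1 m)) eqxx.
have ps : below_side V E false i s.
  split=> //; have -> : s = - u m - t by rewrite umst addrK.
  apply: lin_closedB; first exact: side_space_closed.
    rewrite -scaleN1r; apply: lin_closedZ; first exact: side_space_closed.
    exact: (summand_side true (au.1 m)).
  by apply: lower_side_sub pt.1.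
have bm : F_below V (interval_sq m) i (- u m).
  rewrite umst; apply: lin_closedD; first exact: below_closed.
    exact: (below_side_sub ho mE iE ps).
  exact: (below_side_sub ho mE iE pt).
have {}bm : F_below V (interval_sq m) i (u m).
  by rewrite -[u m]opprK -scaleN1r; apply: lin_closedZ => //; exact: below_closed.
by move: um0; rewrite (core_rep_below (au.1 m) bm) eqxx.
Qed.

End Decomposition.

Theorem theorem1 (F : fieldType) (o : int -> bool) (ho : eventually_outward o)
    (V : rep F (line o)) :
  (exists (I : choiceType) (U : I -> subrep V),
     is_direct_sum U /\
     forall k : I, exists a : csubquiver (line o),
       rep_iso (sub_rep (U k)) (W_rep V a)) /\
  (forall a : csubquiver (line o), isotypic (W_rep V a)).
Proof.
split.
  exists interval, (summand ho V); split.
    apply: direct_sumP; first exact: summand_span.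
    exact: summand_indep.
  by move=> p; exists (interval_sq o p); apply: core_iso => //; exact: interval_csub_ends.
move=> a; have [E aE] := csub_ends a; have [C HC] := core_exists ho V aE.
exact: W_rep_isotypic HC.
Qed.
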